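(* Let $\alpha\in(0,1)$, $\beta>0$, $a<b$, and $L(t,x,v,w,z)$, $l(t,x,v,w)$ real $C^1$ functions. For $x\in\mathcal F([a,b];\mathbb R)$ let $\{x\}(t)=(t,x(t),{^C_aD_t^\alpha}x(t),{_aI_t^\beta}x(t))$, $z(t)=\int_a^t l\{x\}(\tau)d\tau$, $[x](t)=(t,x(t),{^C_aD_t^\alpha}x(t),{_aI_t^\beta}x(t),z(t))$ and $J[x]=\int_a^b L[x](t)dt$. Let $x\in\mathcal F([a,b];\mathbb R)$ satisfy, for all $t\in[a,b]$, \begin{multline*} \frac{\partial L}{\partial x}[x](t)+{_tD^\alpha_b}\left(\frac{\partial L}{\partial v}[x](t)\right)+{_tI_b^\beta}\left(\frac{\partial L}{\partial w}[x](t)\right)+\int_t^b\frac{\partial L}{\partial z}[x](\tau)d\tau\cdot\frac{\partial l}{\partial x}\{x\}(t)\\ +{_tD^\alpha_b}\left(\int_t^b\frac{\partial L}{\partial z}[x](\tau)d\tau\cdot\frac{\partial l}{\partial v}\{x\}(t)\right)+{_tI^\beta_b}\left(\int_t^b\frac{\partial L}{\partial z}[x](\tau)d\tau\cdot\frac{\partial l}{\partial w}\{x\}(t)\right)=0, \end{multline*} and the natural boundary condition \[ \left[{_tI_b^{1-\alpha}}\left(\frac{\partial L}{\partial v}[x](t)+\int_t^b\frac{\partial L}{\partial z}[x](\tau)d\tau\cdot\frac{\partial l}{\partial v}\{x\}(t)\right)\right]_{t=a}=0. \] Assume $L$ is convex in $(x,v,w,z)$. If either (1) $l$ is convex in $(x,v,w)$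 and $\frac{\partial L}{\partial z}[x](t)\ge0$ for all $t\in[a,b]$, or (2) $l$ is concave in $(x,v,w)$ and $\frac{\partial L}{\partial z}[x](t)\le0$ for all $t\in[a,b]$, then $x$ is a global minimizer of $J$ on $\mathcal F([a,b];\mathbb R)$.
   Context: $\mathcal F([a,b];\mathbb R)$: absolutely continuous $x:[a,b]\to\mathbb R$ with ${^C_aD_t^\alpha}x$ and ${_aI_t^\beta}x$ existing and continuous on $[a,b]$. For $\gamma>0$: ${_aI_t^\gamma}x(t)=\frac{1}{\Gamma(\gamma)}\int_a^t(t-\tau)^{\gamma-1}x(\tau)d\tau$, ${_tI_b^\gamma}x(t)=\frac{1}{\Gamma(\gamma)}\int_t^b(\tau-t)^{\gamma-1}x(\tau)d\tau$; ${^C_aD_t^\alpha}x(t)=\frac{1}{\Gamma(1-\alpha)}\int_a^t(t-\tau)^{-\alpha}\dot x(\tau)d\tau$, ${_tD_b^\alpha}x(t)=-\frac{1}{\Gamma(1-\alpha)}\frac{d}{dt}\int_t^b(\tau-t)^{-\alpha}x(\tau)d\tau$. A $C^1$ function $\Psi(t_1,\ldots,t_n)$ is convex (concave) in $(t_k,\ldots,t_n)$ if $\Psi(t_1+\theta_1,\ldots,t_n+\theta_n)-\Psi(t_1,\ldots,t_n)\ge(\le)\sum_{i=k}^n\frac{\partial\Psi}{\partial t_i}(t_1,\ldots,t_n)\theta_i$ for all admissible points. *)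

(* Defs.v *)
From HB Require Import structures.
From mathcomp Require Import all_boot all_order all_algebra.
From mathcomp Require Import all_classical all_reals all_analysis.
Set Implicit Arguments. Unset Strict Implicit. Unset Printing Implicit Defensive.
Import Order.TTheory GRing.Theory Num.Theory.
Import numFieldNormedType.Exports.
Local Open Scope classical_set_scope.
Local Open Scope ring_scope.

Section FracDefs.
Variable R : realType.
Notation mu := (@lebesgue_measure R).

Definition Gamma (g : R) : R :=
  \int[mu]_(s in `]0, +oo[) (s `^ (g - 1) * expR (- s)).

Definition lRLint (g a : R) (x : R -> R) (t : R) : R :=
  (Gamma g)^-1 * \int[mu]_(tau in `[a, t]) ((t - tau) `^ (g - 1) * x tau).

Definition lRLint_exists (g a : R) (x : R -> R) (t : R) : Prop :=
  mu.-integrable `[a, t] (fun tau => ((t - tau) `^ (g - 1) * x tau)%:E).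

Definition rRLint (g b : R) (x : R -> R) (t : R) : R :=
  (Gamma g)^-1 * \int[mu]_(tau in `[t, b]) ((tau - t) `^ (g - 1) * x tau).

(* left Caputo derivative  ^C_aD_t^al x (t), with xdot the (a.e.) derivative *)
Definition lCaputo (al a : R) (x : R -> R) (t : R) : R :=
  (Gamma (1 - al))^-1 * \int[mu]_(tau in `[a, t]) ((t - tau) `^ (- al) * derive1 x tau).

Definition lCaputo_exists (al a : R) (x : R -> R) (t : R) : Prop :=
  mu.-integrable `[a, t] (fun tau => ((t - tau) `^ (- al) * derive1 x tau)%:E).

(* derivative of f at t in [a,b], taken within [a,b]
   (one-sided at the end points, usual derivative in the interior) *)
Definition dquot (f : R -> R) (t : R) : R -> R := fun h => h^-1 * (f (t + h) - f t).
Definition within_ab (a b t : R) : set R := [set h | h != 0 /\ a <= t + h <= b].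
Definition deriv_in (a b : R) (f : R -> R) (t : R) : R :=
  lim (dquot f t @ within (within_ab a b t) (nbhs (0 : R))).
Definition derivable_in (a b : R) (f : R -> R) (t : R) : Prop :=
  cvg (dquot f t @ within (within_ab a b t) (nbhs (0 : R))).

Definition rRLpot (al b : R) (g : R -> R) (t : R) : R :=
  \int[mu]_(tau in `[t, b]) ((tau - t) `^ (- al) * g tau).
Definition rRLder (al a b : R) (g : R -> R) (t : R) : R :=
  - ((Gamma (1 - al))^-1 * deriv_in a b (rRLpot al b g) t).
Definition rRLder_exists (al a b : R) (g : R -> R) (t : R) : Prop :=
  derivable_in a b (rRLpot al b g) t.

Definition abs_cont_on (a b : R) (x : R -> R) : Prop :=
  forall eps : R, 0 < eps -> exists2 del : R, 0 < del &
    forall (n : nat) (c d : 'I_n -> R),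
      (forall i, a <= c i /\ c i <= d i /\ d i <= b) ->
      (forall i j, i != j -> d i <= c j \/ d j <= c i) ->
      \sum_(i < n) (d i - c i) < del ->
      \sum_(i < n) `|x (d i) - x (c i)| < eps.

Definition Fclass (al be a b : R) (x : R -> R) : Prop :=
  [/\ abs_cont_on a b x,
      (forall t, a <= t <= b -> lCaputo_exists al a x t),
      (forall t, a <= t <= b -> lRLint_exists be a x t),
      {within `[a, b], continuous (lCaputo al a x)} &
      {within `[a, b], continuous (lRLint be a x)}].

Definition pd5_1 (L : R -> R -> R -> R -> R -> R) t x v w z := derive1 (fun s => L s x v w z) t.
Definition pd5_2 (L : R -> R -> R -> R -> R -> R) t x v w z := derive1 (fun s => L t s v w z) x.
Definition pd5_3 (L : R -> R -> R -> R -> R -> R) t x v w z := derive1 (fun s => L t x s w z) v.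
Definition pd5_4 (L : R -> R -> R -> R -> R -> R) t x v w z := derive1 (fun s => L t x v s z) w.
Definition pd5_5 (L : R -> R -> R -> R -> R -> R) t x v w z := derive1 (fun s => L t x v w s) z.
Definition pd4_1 (l : R -> R -> R -> R -> R) t x v w := derive1 (fun s => l s x v w) t.
Definition pd4_2 (l : R -> R -> R -> R -> R) t x v w := derive1 (fun s => l t s v w) x.
Definition pd4_3 (l : R -> R -> R -> R -> R) t x v w := derive1 (fun s => l t x s w) v.
Definition pd4_4 (l : R -> R -> R -> R -> R) t x v w := derive1 (fun s => l t x v s) w.

Definition C1_5 (L : R -> R -> R -> R -> R -> R) : Prop :=
  (forall t x v w z,
     [/\ derivable (fun s => L s x v w z) t 1, derivable (fun s => L t s v w z) x 1,
         derivable (fun s => L t x s w z) v 1, derivable (fun s => L t x v s z) w 1 &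
         derivable (fun s => L t x v w s) z 1]) /\
  let c (P : (R -> R -> R -> R -> R -> R) -> R -> R -> R -> R -> R -> R) :=
     continuous (fun p : R * R * R * R * R =>
                   P L p.1.1.1.1 p.1.1.1.2 p.1.1.2 p.1.2 p.2) in
  [/\ c pd5_1, c pd5_2, c pd5_3, c pd5_4 & c pd5_5].

Definition C1_4 (l : R -> R -> R -> R -> R) : Prop :=
  (forall t x v w,
     [/\ derivable (fun s => l s x v w) t 1, derivable (fun s => l t s v w) x 1,
         derivable (fun s => l t x s w) v 1 & derivable (fun s => l t x v s) w 1]) /\
  let c (P : (R -> R -> R -> R -> R) -> R -> R -> R -> R -> R) :=
     continuous (fun p : R * R * R * R => P l p.1.1.1 p.1.1.2 p.1.2 p.2) in
  [/\ c pd4_1, c pd4_2, c pd4_3 & c pd4_4].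

Definition convex5 (L : R -> R -> R -> R -> R -> R) : Prop :=
  forall t x v w z th2 th3 th4 th5,
    L t (x + th2) (v + th3) (w + th4) (z + th5) - L t x v w z >=
    pd5_2 L t x v w z * th2 + pd5_3 L t x v w z * th3 +
    pd5_4 L t x v w z * th4 + pd5_5 L t x v w z * th5.
Definition convex4 (l : R -> R -> R -> R -> R) : Prop :=
  forall t x v w th2 th3 th4,
    l t (x + th2) (v + th3) (w + th4) - l t x v w >=
    pd4_2 l t x v w * th2 + pd4_3 l t x v w * th3 + pd4_4 l t x v w * th4.
Definition concave4 (l : R -> R -> R -> R -> R) : Prop :=
  forall t x v w th2 th3 th4,
    l t (x + th2) (v + th3) (w + th4) - l t x v w <=
    pd4_2 l t x v w * th2 + pd4_3 l t x v w * th3 + pd4_4 l t x v w * th4.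

Definition zvar (al be a : R) (l : R -> R -> R -> R -> R) (x : R -> R) (t : R) : R :=
  \int[mu]_(tau in `[a, t]) l tau (x tau) (lCaputo al a x tau) (lRLint be a x tau).

Definition Jfun (al be a b : R) (L : R -> R -> R -> R -> R -> R)
    (l : R -> R -> R -> R -> R) (x : R -> R) : R :=
  \int[mu]_(t in `[a, b])
     L t (x t) (lCaputo al a x t) (lRLint be a x t) (zvar al be a l x t).


Definition along5 (al be a : R) (P : (R -> R -> R -> R -> R -> R) -> R -> R -> R -> R -> R -> R)
    (L : R -> R -> R -> R -> R -> R) (l : R -> R -> R -> R -> R) (x : R -> R) (t : R) : R :=
  P L t (x t) (lCaputo al a x t) (lRLint be a x t) (zvar al be a l x t).
Definition along4 (al be a : R) (P : (R -> R -> R -> R -> R) -> R -> R -> R -> R -> R)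
    (l : R -> R -> R -> R -> R) (x : R -> R) (t : R) : R :=
  P l t (x t) (lCaputo al a x t) (lRLint be a x t).

Definition tailLz (al be a b : R) (L : R -> R -> R -> R -> R -> R)
    (l : R -> R -> R -> R -> R) (x : R -> R) (t : R) : R :=
  \int[mu]_(tau in `[t, b]) along5 al be a pd5_5 L l x tau.

End FracDefs.
Arguments pd5_1 {R}. Arguments pd5_2 {R}. Arguments pd5_3 {R}.
Arguments pd5_4 {R}. Arguments pd5_5 {R}.
Arguments pd4_1 {R}. Arguments pd4_2 {R}. Arguments pd4_3 {R}. Arguments pd4_4 {R}.

(* Main.v *)
(* Testing the Euler-Lagrange equation against an admissible curve u and integrating
   by parts shows that, with A = L_x + T l_x, B = L_v + T l_v, C = L_w + T l_w taken
   along x and T(t) the integral of L_z[x] over [t, b], the pairing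
   int_a^b (A u + B D^al u + C I^be u) vanishes for every u in F([a, b]); the natural
   boundary condition is needed because u(a) and u(b) are free.  By convexity,
   J[y] - J[x] is at least the pairing of y - x, once the term
   L_z (z_y - z_x) has been bounded below (by the sign condition on L_z) and the
   order of integration has been exchanged; hence J[y] >= J[x].
   The integration by parts rests on the fundamental theorem of calculus for
   absolutely continuous functions: the total variation splits such a function into
   nondecreasing absolutely continuous ones, whose Lebesgue-Stieltjes measures are
   absolutely continuous with respect to Lebesgue measure, and the Radon-Nikodym
   density is the derivative almost everywhere by Lebesgue differentiation. *)
Require Import Defs.
From HB Require Import structures.
From mathcomp Require Import all_boot all_order all_algebra.
From mathcomp Require Import all_classical all_reals all_analysis.
From mathcomp Require Import measurable_realfun ring lra.
Set Implicit Arguments.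
Unset Strict Implicit.
Unset Printing Implicit Defensive.
Import Order.TTheory GRing.Theory Num.Theory.
Import numFieldNormedType.Exports.
Local Open Scope classical_set_scope.
Local Open Scope ring_scope.

(** * Absolutely continuous functions *)

Section AC.
Variable R : realType.
Implicit Types (G F x : R -> R) (a b c d : R) (s : seq (R * R)).

(** Composition with [clamp a b] extends a function from [a, b] to the whole line by its end values,
    so that points need not be kept inside the segment. *)
Definition clamp a b t : R := Num.max a (Num.min t b).

Lemma clamp_itv a b t : a <= b -> a <= clamp a b t <= b.
Proof.
by move=> ab; rewrite /clamp le_max lexx/= ge_max ab/= ge_min lexx orbT.
Qed.

Lemma clamp_id a b t : a <= t <= b -> clamp a b t = t.
Proof. by case/andP => at_ tb; rewrite /clamp (min_idPl tb); exact/max_idPr. Qed.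

Lemma clamp_nd a b : {homo clamp a b : c d / c <= d}.
Proof.
by move=> c d cd; rewrite /clamp; apply: le_max2; rewrite ?le_min2.
Qed.

Lemma clamp_contract a b c d : c <= d -> clamp a b d - clamp a b c <= d - c.
Proof.
rewrite /clamp /Num.max /Num.min.
by do ![case: ifPn]; rewrite -?leNgt; lra.
Qed.

Definition apart (p q : R * R) := (p.2 <= q.1) || (q.2 <= p.1).

(** Lists replace the families indexed by ['I_n] in [abs_cont_on]: they can be concatenated and
    refined by induction. Degenerate intervals and shared end points are allowed. *)
Definition family s := all (fun p => p.1 <= p.2) s && pairwise apart s.

Definition abs_cont G := forall eps : R, 0 < eps -> exists2 del : R, 0 < del &
  forall s, family s -> \sum_(p <- s) (p.2 - p.1) < del ->
    \sum_(p <- s) `|G p.2 - G p.1| < eps.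

(** [clamp a b] is nondecreasing and does not increase lengths, so the clamped intervals lie in
    [a, b], stay disjoint, and the same [del] works. *)
Lemma abs_cont_clamp a b x : a <= b -> abs_cont_on a b x ->
  abs_cont (x \o clamp a b).
Proof.
move=> ab xac eps /xac[del del0 H]; exists del => // s /andP[/allP sle spw] sdel.
pose p0 : R * R := (0, 0).
rewrite (big_nth p0) big_mkord.
apply: (H _ (fun i => clamp a b (nth p0 s i).1)
            (fun i => clamp a b (nth p0 s i).2)).
- move=> i; have /sle icd : nth p0 s i \in s by exact: mem_nth.
  have /andP[-> _] := clamp_itv (nth p0 s i).1 ab.
  by have /andP[_ ->] := clamp_itv (nth p0 s i).2 ab; rewrite clamp_nd.
- move/(pairwiseP p0) : spw => spw.
  move=> i j; rewrite neq_ltn => /orP[] /spw; rewrite !inE !ltn_ord;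
    move=> /(_ isT isT)/orP[] /(clamp_nd a b); tauto.
- apply: le_lt_trans sdel; rewrite [leRHS](big_nth p0) big_mkord.
  apply: ler_sum => i _; apply: clamp_contract.
  by apply: sle; exact: mem_nth.
Qed.

Lemma abs_cont_le G F : abs_cont G ->
  (exists M, forall c d, c <= d -> `|F d - F c| <= M * `|G d - G c|) ->
  abs_cont F.
Proof.
move=> Gac [M FG] eps eps0.
have M0 : 0 < `|M| + 1 by rewrite ltr_wpDl.
have [|del del0 H] := Gac (eps / (`|M| + 1)); first by rewrite divr_gt0.
exists del => // s sf /(H _ sf) {}H.
rewrite -(@ltr_pM2r _ (`|M| + 1)^-1) ?invr_gt0//; apply: le_lt_trans H.
rewrite mulr_suml big_seq [leRHS]big_seq; apply: ler_sum => p ps.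
rewrite ler_pdivrMr// mulrC.
have /FG/le_trans : p.1 <= p.2 by move/andP : sf => [/allP/(_ _ ps)].
by apply; apply: ler_wpM2r => //; rewrite (le_trans (ler_norm M))// lerDl.
Qed.

(** Consecutive points of a partition give an admissible family whose lengths telescope; this lets a
    partition be spliced into another family. *)
Lemma partition_family a b l : itv_partition a b l ->
  let s := zip (a :: l) l in
  [/\ all (fun p => (a <= p.1) && (p.1 <= p.2) && (p.2 <= b)) s,
      pairwise apart s & \sum_(p <- s) (p.2 - p.1) = b - a].
Proof.
elim: l a => [a /itv_partition_nil -> /=|h t ih a abl].
  by rewrite big_nil subrr.
have hb := itv_partition_le (itv_partition_cons abl).
have ah : a < h by case: abl => /= /andP[].
have [h1 h2 h3] := ih _ (itv_partition_cons abl); split => /=.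
- rewrite lexx hb (ltW ah)/=; apply: sub_all h1 => p /andP[/andP[hp -> ->]].
  by rewrite (le_trans (ltW ah) hp).
- rewrite h2 andbT; apply: sub_all h1 => p /andP[/andP[hp _ _]].
  by rewrite /apart /= hp.
- by rewrite big_cons h3/=; ring.
Qed.

(** * Total variation of absolutely continuous functions *)

Notation TV := (@total_variation R).

(* The modulus of absolute continuity passes from increments to total variations:
   in the induction one interval after the other is replaced by an arbitrary
   partition of it, which keeps the family disjoint and its total length fixed. *)
Lemma sum_total_variation_le G eps del :
  (forall s, family s -> \sum_(p <- s) (p.2 - p.1) < del ->
    \sum_(p <- s) `|G p.2 - G p.1| < eps) ->
  forall s1 s2, family (s1 ++ s2) -> \sum_(p <- s1 ++ s2) (p.2 - p.1) < del ->
  (\sum_(p <- s1) TV p.1 p.2 G + (\sum_(p <- s2) `|G p.2 - G p.1|)%:E <= eps%:E)%E.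
Proof.
move=> H; elim => [|p s1 ih] s2 sf sdel.
  by rewrite big_nil add0e lee_fin ltW// H.
move: sf; rewrite /family /= => /andP[/andP[pp sle] /andP[/allP papart spw]].
have ih0 : (\sum_(p <- s1) TV p.1 p.2 G +
    (\sum_(p <- s2) `|G p.2 - G p.1|)%:E <= eps%:E)%E.
  apply: ih; first by rewrite /family sle.
  by apply: le_lt_trans sdel; rewrite /= big_cons lerDr subr_ge0.
(* Finiteness of this sum allows it to be moved across the inequality; what remains is a supremum
   over the partitions of the first interval. *)
have s1f : (\sum_(p <- s1) TV p.1 p.2 G)%E \is a fin_num.
  rewrite ge0_fin_numE; last first.
    rewrite big_seq; apply: sume_ge0 => q qs1; apply: total_variation_ge0.
    by move/allP : sle; apply; rewrite mem_cat qs1.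
  apply: le_lt_trans (ltry eps); apply: le_trans ih0; rewrite leeDl// lee_fin.
  exact: sumr_ge0.
rewrite big_cons -addeA -leeBrDr ?fin_numD ?s1f//.
apply: ge_ereal_sup => _ [_ [l pl <-] <-].
rewrite leeBrDr ?fin_numD ?s1f//.
rewrite (variation_zip _ pl) addeCA -EFinD.
have [h1 h2 h3] := partition_family pl.
have -> : \sum_(q <- zip l (p.1 :: l)) `|G q.1 - G q.2| =
          \sum_(q <- zip (p.1 :: l) l) `|G q.2 - G q.1|.
  clear; elim: l p.1 => [|h t IH] c; first by rewrite !big_nil.
  by rewrite /= !big_cons IH.
rewrite -big_cat; apply: ih; last first.
  apply: le_lt_trans sdel; rewrite /= big_cons !big_cat/= h3.
  by rewrite addrCA.
rewrite /family all_cat all_cat -andbA.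
move: sle; rewrite all_cat => /andP[-> ->]; rewrite andbT/=.
rewrite (sub_all _ h1)/=; last by move=> q /andP[/andP[]].
move: spw; rewrite !pairwise_cat => /and3P[s12 -> ->]; rewrite h2 /= !andbT.
apply/andP; split; apply/allrelP => u v.
- move=> us1; rewrite mem_cat => /orP[vl|vs2]; last by move/allrelP : s12; apply.
  have := papart u; rewrite mem_cat us1 => /(_ isT); rewrite /apart.
  move/allP : h1 => /(_ _ vl)/andP[/andP[? ?] ?] /orP[pu|pu]; apply/orP.
    by right; exact: le_trans pu.
  by left; exact: le_trans pu _.
- move=> ul vs2.
  have := papart v; rewrite mem_cat vs2 orbT => /(_ isT); rewrite /apart.
  move/allP : h1 => /(_ _ ul)/andP[/andP[? ?] ?] /orP[pu|pu]; apply/orP.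
    by left; exact: le_trans pu.
  by right; exact: le_trans pu _.
Qed.

(** Taking [eps := 1], the variation is at most 1 on every interval shorter than [del]; finitely
    many such intervals make up [a, b], and the variation is additive. *)
Lemma abs_cont_total_variation_fin G a b : abs_cont G -> a <= b ->
  TV a b G \is a fin_num.
Proof.
move=> Gac ab; have [del del0 H] := Gac 1 ltr01.
have small c d : c <= d -> d - c < del -> (TV c d G < +oo)%E.
  move=> cd cddel; have := @sum_total_variation_le _ _ _ H [:: (c, d)] [::].
  rewrite /= !big_seq1 big_nil adde0 /family/= cd => /(_ isT cddel).
  by move=> /le_lt_trans; apply; rewrite ltry.
(* Pieces of length [del / 2] are cut off one by one, so that [small], which asks for a length
   strictly below [del], applies to each. *)
have ind n c d : c <= d -> d - c < n.+1%:R * (del / 2) -> (TV c d G < +oo)%E.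
  elim: n c d => [|n ih] c d cd dc.
    by apply: small => //; apply: (lt_le_trans dc); rewrite mul1r; lra.
  have [dc2|dc2] := ltP (d - c) (del / 2); first by apply: small => //; lra.
  rewrite (@total_variationD _ c d (c + del / 2)); [|lra|lra].
  rewrite lte_add_pinfty//; first by apply: small; lra.
  by apply: ih; [lra|move: dc; rewrite -[n.+2]addn1 natrD mulrDl mul1r; lra].
rewrite ge0_fin_numE ?total_variation_ge0//.
apply: (ind (Num.truncn ((b - a) / (del / 2)))) => //.
rewrite -ltr_pdivrMr; last lra.
by apply: truncnS_gt.
Qed.

(** By additivity an increment of [V] is the total variation of [G] over the clamped interval, so
    [sum_total_variation_le] transfers the modulus from [G] to [V]. *)
Lemma abs_cont_variation G a b : abs_cont G -> a <= b ->
  let V t := fine (TV a (clamp a b t) G) in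
  [/\ abs_cont V,
      forall c d, c <= d -> `|G (clamp a b d) - G (clamp a b c)| <= V d - V c &
      {homo V : c d / c <= d}].
Proof.
move=> Gac ab V.
have VE c d : c <= d -> V d - V c = fine (TV (clamp a b c) (clamp a b d) G).
  move=> cd; have /andP[ac cb] := clamp_itv c ab.
  have /andP[ad db] := clamp_itv d ab.
  rewrite /V (@total_variationD _ a _ (clamp a b c))// ?clamp_nd//.
  by rewrite fineD ?abs_cont_total_variation_fin ?clamp_nd// addrC addKr.
have Vge c d : c <= d -> `|G (clamp a b d) - G (clamp a b c)| <= V d - V c.
  move=> cd; rewrite VE// -lee_fin fineK ?abs_cont_total_variation_fin ?clamp_nd//.
  by rewrite total_variation_ge// clamp_nd.
have Vnd : {homo V : c d / c <= d}.
  by move=> c d cd; rewrite -subr_ge0; exact: le_trans (Vge _ _ cd).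
(* Half of [eps], because the bound on sums of variations is not strict. *)
split => // eps eps0; have [|del del0 H] := Gac (eps / 2); first lra.
exists del => // s /andP[/allP sle spw] sdel.
apply: (@le_lt_trans _ _ (eps / 2)); last lra.
pose s' := [seq (clamp a b p.1, clamp a b p.2) | p <- s].
have := @sum_total_variation_le _ _ _ H s' [::].
rewrite cats0 big_nil adde0 big_map => /(_ _ _)/le_trans Hs.
rewrite -lee_fin; apply: le_trans (Hs _ _ _ (lexx _)).
- rewrite -sumEFin big_map big_seq [leRHS]big_seq; apply: lee_sum => p /sle pp.
  rewrite ger0_norm ?subr_ge0 ?Vnd// VE// fineK//.
  by rewrite abs_cont_total_variation_fin ?clamp_nd.
- apply/andP; split.
    by apply/allP => _ /mapP[p /sle pp ->]; rewrite clamp_nd.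
  rewrite pairwise_map; apply: sub_pairwise spw => p q.
  by rewrite /apart /= => /orP[]/(clamp_nd a b) ->; rewrite ?orbT.
- apply: le_lt_trans sdel; rewrite big_seq [leRHS]big_seq.
  by apply: ler_sum => p /sle; exact: clamp_contract.
Qed.

Lemma abs_cont_continuous G : abs_cont G -> continuous G.
Proof.
move=> Gac t; apply/cvgrPdist_lt => eps /Gac[del del0 H]; near=> u.
have tu : `|t - u| < del by near: u; exact: cvgr_dist_lt.
have [ut|tu'] := leP u t.
  have := H [:: (u, t)]; rewrite !big_seq1/=; apply.
    by rewrite /family/= ut.
  exact: le_lt_trans (ler_norm _) tu.
rewrite distrC; have := H [:: (t, u)]; rewrite !big_seq1/=; apply.
  by rewrite /family/= (ltW tu').
by apply: le_lt_trans (ler_norm _) _; rewrite distrC.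
Unshelve. all: by end_near. Qed.

(** * Lebesgue-Stieltjes measures of absolutely continuous functions *)

Lemma lebesgue_stieltjes_ocitv (F : cumulative R R) c d : c <= d ->
  lebesgue_stieltjes_measure F `]c, d] = (F d - F c)%:E.
Proof.
move=> cd; rewrite /lebesgue_stieltjes_measure /measure_extension.
by rewrite measurable_mu_extE/=; [exact: wlength_itv_bnd|exact: is_ocitv].
Qed.

Lemma sub_ocitv_measurable (X : set R) : ocitv X -> measurable X.
Proof. exact: sub_sigma_algebra. Qed.

Lemma ocitv_apart (p q : R * R) : p.1 < p.2 -> q.1 < q.2 ->
  `]p.1, p.2] `&` `]q.1, q.2] = set0 -> apart p q.
Proof.
move=> pp qq pq0; apply/negP => /negP; rewrite negb_or -!ltNge => /andP[h1 h2].
(* The smaller of the two right end points would lie in both intervals. *)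
suff : set0 (Num.min p.2 q.2) by [].
rewrite -pq0; split; rewrite /= in_itv/= lt_min ge_min lexx ?orbT ?pp ?qq ?h1 ?h2//.
Qed.

(** A set of the ring is a finite disjoint union of half-open intervals: its Lebesgue measure is
    their total length and its Stieltjes measure the sum of the increments of [F]. *)
Lemma lebesgue_stieltjes_ring_le (F : cumulative R R) (eps del : R) :
  (forall s, family s -> \sum_(p <- s) (p.2 - p.1) < del ->
    \sum_(p <- s) `|F p.2 - F p.1| < eps) ->
  forall E : set R, measurable (E : set (SetRing.type (ocitv_type R))) ->
  (lebesgue_measure E < del%:E -> lebesgue_stieltjes_measure F E <= eps%:E)%E.
Proof.
move=> H E mE.
have [D [Dfin D0 Dtriv Doc EE]] := SetRing.ring_finite_set mE.
have Dm (X : set R) : D X -> measurable X.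
  by move=> DX; apply: sub_ocitv_measurable; apply: Doc; rewrite inE.
have Emu : lebesgue_measure E = (\sum_(X \in D) lebesgue_measure (X : set R))%E.
  by rewrite {1}EE; apply: measure_fin_bigcup.
have Enu : lebesgue_stieltjes_measure F E =
    (\sum_(X \in D) lebesgue_stieltjes_measure F (X : set R))%E.
  by rewrite {1}EE; apply: measure_fin_bigcup.
have /choice[f fP] : forall X : set R, exists p : R * R,
    D X -> p.1 < p.2 /\ X = `]p.1, p.2]%classic.
  move=> X; have [DX|nX] := pselect (D X); last by exists (0, 0).
  have := Doc _ (mem_set DX); move=> [p _ pX]; exists p => _; split => //.
  have := D0 _ DX; rewrite -pX => /set0P; apply: contraNT => pp.
  by rewrite set_itv_ge// bnd_simp.
pose s := [seq f X | X <- finmap.enum_fset (fset_set D)].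
have sf : family s.
  apply/andP; split.
    apply/allP => p /mapP[X]; rewrite in_fset_set// inE => DX ->.
    by apply: ltW; case: (fP _ DX).
  rewrite pairwise_map.
  apply: (@sub_in_pairwise _ (mem D) [rel x y | x != y]) => /=.
  - move=> X Y; rewrite !inE/= => DX DY XY.
    have [fX XE] := fP _ DX; have [fY YE] := fP _ DY.
    apply: ocitv_apart => //; rewrite -XE -YE.
    by have /trivIsetP tr := Dtriv; exact: tr.
  - by apply/allP => X; rewrite in_fset_set// inE.
  - by rewrite -uniq_pairwise finmap.fset_uniq.
move: Emu Enu; rewrite !fsbig_finite//= => Emu Enu.
(* Stated for every [G] because it serves twice: for [F], and for the identity, whose Stieltjes
   measure is Lebesgue measure. *)
have sumE (G : cumulative R R) :
   (\sum_(X <- finmap.enum_fset (fset_set D)) lebesgue_stieltjes_measure G (X : set R) =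
   (\sum_(p <- s) (G p.2 - G p.1))%:E)%E.
  rewrite big_map -sumEFin big_seq [RHS]big_seq; apply: eq_bigr => X.
  rewrite in_fset_set// inE => /fP[fX XE].
  by rewrite {1}XE; apply: lebesgue_stieltjes_ocitv; exact: ltW.
rewrite Emu Enu !sumE lte_fin lee_fin => /(H _ sf)/ltW; apply: le_trans.
by apply: ler_sum => p _; exact: ler_norm.
Qed.

Lemma lebesgue_stieltjes_dominated (F : cumulative R R) :
  abs_cont F -> lebesgue_stieltjes_measure F `<< (@lebesgue_measure R).
Proof.
move=> Fac; apply/null_content_dominatesP => A mA A0.
apply/eqP; rewrite eq_le measure_ge0 andbT.
apply/lee_addgt0Pr => eps eps0; rewrite add0e.
have [del del0 H] := Fac _ eps0.
have : (lebesgue_measure A < del%:E)%E by rewrite A0 lte_fin.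
(* The infimum that defines the outer measure yields a cover of [A] by half-open intervals [B k] of
   total length below [del]. *)
rewrite {1}/lebesgue_measure /lebesgue_stieltjes_measure /measure_extension.
rewrite /mu_ext => /ereal_inf_lt[_ [B [mB AB] <-] sumB].
(* The finite unions belong to the ring, where the bound by [eps] is known; it passes to the whole
   cover by continuity from below. *)
pose E n := \big[setU/set0]_(i < n) B i.
have mE n : (R.-ocitv.-ring).-measurable (E n : set (SetRing.type (ocitv_type R))).
  by apply: bigsetU_measurable => i _; exact: SetRing.measurable_subring.
have mE' n : measurable (E n : set R).
  apply: (@bigsetU_measurable _ (measurableTypeR R)) => i _.
  exact: (sub_ocitv_measurable (mB i)).
have BE : \bigcup_k B k = \bigcup_n E n.
  apply/seteqP; split=> [u [k _ Bku]|u [n _]]; last first.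
    by rewrite /E -bigcup_mkord => -[k _ Bku]; exists k.
  by exists k.+1 => //; rewrite /E -bigcup_mkord; exists k => /=.
apply: (@le_trans _ _ (lebesgue_stieltjes_measure F (\bigcup_n E n))).
  apply: le_measure; rewrite ?inE//; last by rewrite -BE.
  exact: bigcupT_measurable.
have cvE : (lebesgue_stieltjes_measure F \o E) n @[n --> \oo] -->
    lebesgue_stieltjes_measure F (\bigcup_n E n).
  apply: nondecreasing_cvg_mu => //; first exact: bigcupT_measurable.
  by move=> m n mn; apply/subsetPset; exact: subset_bigsetU.
rewrite -(cvg_lim _ cvE)//; apply: lime_le.
  by apply/cvg_ex; eexists; exact: cvE.
apply: nearW => n /=; apply: (lebesgue_stieltjes_ring_le H) => //.
apply: le_lt_trans sumB.
apply: (@le_trans _ _ (\sum_(k < n) lebesgue_measure (B k : set R))%E).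
  apply: (@content_subadditive _ _ _ (@lebesgue_measure R)) => [k _||].
  - exact: (sub_ocitv_measurable (mB k)).
  - exact: mE'.
  - exact: subset_refl.
rewrite -(big_mkord xpredT (fun k => lebesgue_measure (B k : set R))).
have -> : (\sum_(0 <= k < n) lebesgue_measure (B k : set R) =
    \sum_(0 <= k < n) wlength idfun (B k))%E.
  apply: eq_bigr => k _; rewrite /lebesgue_measure /lebesgue_stieltjes_measure.
  by rewrite /measure_extension measurable_mu_extE.
by apply: nneseries_lim_ge => k _ _; exact: measure_ge0.
Qed.

(** Radon-Nikodym for the Stieltjes measure of [F], restricted to []a, b]] to make it finite. The
    closed interval in the conclusion differs from []a, t]] by a null point. *)
Lemma abs_cont_nondecreasing_density F a b : a <= b -> abs_cont F ->
  {homo F : c d / c <= d} ->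
  exists g : R -> R, lebesgue_measure.-integrable setT (EFin \o g) /\
    forall t, a <= t <= b ->
      F t - F a = \int[lebesgue_measure]_(s in `[a, t]) g s.
Proof.
move=> ab Fac Fnd.
have Frc : right_continuous F by apply/right_continuousW/abs_cont_continuous.
pose Fc : cumulative R R := HB.pack F (isCumulative.Build R _ R F Fnd Frc).
pose nu := lebesgue_stieltjes_measure Fc.
have nuab : (nu `]a, b]%classic < +oo)%E by rewrite /nu lebesgue_stieltjes_ocitv// ltry.
have mab : measurable (`]a, b]%classic : set (measurableTypeR R)).
  exact: measurable_itv.
pose nu' := mfrestr mab nuab.
have dom : nu' `<< (@lebesgue_measure R).
  apply/null_content_dominatesP => A mA A0; apply/eqP; rewrite eq_le measure_ge0 andbT.
  apply: (@le_trans _ _ (nu A)).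
    apply: le_measure; rewrite ?inE//. exact: measurableI.
  have /null_content_dominatesP domF := @lebesgue_stieltjes_dominated Fc Fac.
  by rewrite [nu A](domF A mA A0).
have [f [f0 ffin fint fE]] := radon_nikodym_sigma_finite dom.
exists (fine \o f); split.
  by apply: eq_integrable fint => //= t _; rewrite fineK.
move=> t /andP[at_ tb].
rewrite /Rintegral; under eq_integral do rewrite fineK//.
rewrite -integral_itv_obnd_cbnd; last first.
  have fint' : (@lebesgue_measure R).-integrable `]a, t] f.
    by apply: integrableS fint => //; exact: measurable_itv.
  by case/integrableP : fint'.
transitivity (fine (nu (`]a, t] `&` `]a, b])%classic)); last first.
  by congr fine; exact: (fE _ (measurable_itv `]a, t]%R)).
rewrite setIidl; last by apply: subset_itvl; rewrite bnd_simp.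
by rewrite /nu lebesgue_stieltjes_ocitv.
Qed.

Notation mu := (@lebesgue_measure R).

(** The density is the difference of those of [V] and [V - G]. Derivatives are compared at interior
    points only, since [derive1] at an end point sees values of [x] outside the segment. *)
Lemma abs_cont_on_density a b x : a <= b -> abs_cont_on a b x ->
  exists g : R -> R, [/\ mu.-integrable setT (EFin \o g),
    (forall t, a <= t <= b -> x t - x a = \int[mu]_(s in `[a, t]) g s) &
    {ae mu, forall t, a < t < b -> derivable x t 1 /\ derive1 x t = g t}].
Proof.
move=> ab xac.
pose G := x \o clamp a b.
have Gac : abs_cont G by exact: abs_cont_clamp.
have GE t : a <= t <= b -> G t = x t by move=> tab; rewrite /G /= clamp_id.
have [Vac Vge Vnd] := abs_cont_variation Gac ab.
set V := (fun t => fine _) in Vac Vge Vnd.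
have GG c : G (clamp a b c) = G c.
  by rewrite /G /= [clamp a b (clamp a b c)]clamp_id// clamp_itv.
have {}Vge c d : c <= d -> `|G d - G c| <= V d - V c.
  by move=> cd; rewrite -(GG d) -(GG c); exact: Vge.
pose W t := V t - G t.
have Wac : abs_cont W.
  apply: (abs_cont_le Vac); exists 2 => c d cd.
  rewrite (_ : W d - W c = (V d - V c) - (G d - G c)); last by rewrite /W; ring.
  rewrite mulr2n mulrDl mul1r (le_trans (ler_normB _ _))// lerD2l.
  by rewrite (le_trans (Vge _ _ cd))// ler_norm.
have Wnd : {homo W : c d / c <= d}.
  move=> c d cd; rewrite -subr_ge0 /W.
  rewrite (_ : _ - _ = (V d - V c) - (G d - G c)); last by ring.
  by rewrite subr_ge0 (le_trans (ler_norm _))// Vge.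
(* [V] and [V - G] are both nondecreasing and absolutely continuous. *)
have [g1 [g1i g1E]] := abs_cont_nondecreasing_density ab Vac Vnd.
have [g2 [g2i g2E]] := abs_cont_nondecreasing_density ab Wac Wnd.
pose g t := g1 t - g2 t.
have gi : mu.-integrable setT (EFin \o g).
  by rewrite (_ : _ \o _ = (EFin \o g1) \- (EFin \o g2))%E//; exact: integrableB.
have giS A : measurable A -> mu.-integrable A (EFin \o g).
  by move=> mA; exact: integrableS gi.
have xE t : a <= t <= b -> x t - x a = \int[mu]_(s in `[a, t]) g s.
  move=> tab; rewrite RintegralB//; last 2 first.
    - by apply: integrableS g1i.
    - by apply: integrableS g2i.
  have aab : a <= a <= b by rewrite lexx.
  by rewrite -g1E// -g2E// -!GE// /W; ring.
exists g; split => //.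
have locg : locally_integrable [set: R] g.
  have := @integrable_locally R g setT measurableT gi.
  by rewrite patch_setT.
have /= := @FTC1Ny R g (fun y => giS _ (measurable_itv `]-oo, y]%R)) locg.
apply: filterS; first exact: (ae_filter_ringOfSetsType mu).
move=> t [dF FE] /andP[at_ tb].
pose F u := \int[mu]_(s in `]-oo, u]) g s.
(* Near an interior point [x] differs by a constant from the integral of [g] over []-oo, t]], the
   function that [FTC1Ny] differentiates. *)
have near_xF : \near t, (F + cst (x a - F a)) t = x t.
  have tin : t \in `]a, b[ by rewrite in_itv/= at_ tb.
  near=> u.
  have /andP[au ub] : a < u < b.
    suff : u \in `]a, b[ by rewrite in_itv.
    by near: u; exact: near_in_itvoo.
  rewrite /= /F !fctE.
  have := xE u; rewrite !ltW// => /(_ isT) xuE.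
  have := @Rintegral_itvB R g -oo%O (BRight u) a.
  rewrite !bnd_simp (ltW au) => /(_ (giS _ (measurable_itv _)) isT isT).
  rewrite Rintegral_itv_obnd_cbnd; last exact: giS.
  by move=> FB; rewrite addrCA FB -xuE; ring.
have dFd : is_derive t 1 F (g t) by apply: DeriveDef; rewrite -?derive1E.
have [dx dxE] : is_derive t 1 x (g t + 0) by apply: near_eq_is_derive near_xF _.
by rewrite derive1E dxE addr0.
Unshelve. all: by end_near. Qed.

End AC.

(** * Exchanging the order of integration *)

Section Volterra.
Variable R : realType.
Notation mu := (@lebesgue_measure R).
Implicit Types (k f g : R -> R) (a b t : R).

Lemma integrable_EFin_lt f (D : set R) : measurable D -> measurable_fun D f ->
  (\int[mu]_(t in D) (`|f t|)%:E < +oo)%E -> mu.-integrable D (EFin \o f).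
Proof.
move=> mD mf foo; apply/integrableP; split; first exact/measurable_EFinP.
done.
Qed.

Lemma integrable_EFinZl (D : set R) (c : R) f : measurable D ->
  mu.-integrable D (EFin \o f) -> mu.-integrable D (fun t => (c * f t)%:E).
Proof.
move=> mD fi; have := @integrableZl _ _ _ mu D mD c (EFin \o f) fi.
by apply: eq_integrable => // t _; rewrite EFinM.
Qed.

(** Extension by zero turns the triangle s <= t into the plane. The uniform bound [K] on the inner
    integrals dominates the double integral of the absolute value by [K] times the integral of |g|,
    which is what Fubini asks for. *)
Lemma Volterra_Fubini a b k f g (K : R) :
  0 <= K -> measurable_fun setT k -> (forall s, 0 <= k s) ->
  measurable_fun `[a, b] f -> mu.-integrable `[a, b] (EFin \o g) ->
  (forall s, a <= s <= b ->
    (\int[mu]_(t in `[s, b]) (k (t - s) * `|f t|)%:E <= K%:E)%E) ->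
  mu.-integrable `[a, b]
    (fun s => (g s * \int[mu]_(t in `[s, b]) (k (t - s) * f t))%:E) /\
  ((forall t, a <= t <= b ->
    mu.-integrable `[a, t] (fun s => (k (t - s) * g s)%:E)) ->
  \int[mu]_(t in `[a, b]) (f t * \int[mu]_(s in `[a, t]) (k (t - s) * g s)) =
  \int[mu]_(s in `[a, b]) (g s * \int[mu]_(t in `[s, b]) (k (t - s) * f t))).
Proof.
move=> K0 mk k0 mf gi fK.
(* Cutting the kernel off on negative arguments encodes the constraint s <= t. *)
pose kk := k \_ `[(0 : R), +oo[; pose ff := f \_ `[a, b]; pose gg := g \_ `[a, b].
have mkk : measurable_fun setT kk.
  have mk0 : measurable_fun `[(0 : R), +oo[ k by exact: measurable_funTS.
  exact: (measurable_restrictT k (measurable_itv `[(0 : R), +oo[%R)).1 mk0.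
have mff : measurable_fun setT ff.
  exact: (measurable_restrictT f (measurable_itv `[a, b]%R)).1 mf.
have mg : measurable_fun `[a, b] g.
  by apply/measurable_EFinP; case/integrableP : gi.
have mgg : measurable_fun setT gg.
  exact: (measurable_restrictT g (measurable_itv `[a, b]%R)).1 mg.
have ggi : mu.-integrable setT (EFin \o gg).
  by rewrite -restrict_EFin; exact/(integrable_mkcond _ _).1.
have kk0 s : 0 <= kk s by rewrite /kk patchE; case: ifPn.
pose F (p : R * R) : \bar R := (kk (p.1 - p.2) * ff p.1 * gg p.2)%:E.
have mF : measurable_fun setT F.
  apply/measurable_EFinP; apply: measurable_funM; last first.
    by apply: measurableT_comp => //; exact: measurable_snd.
  apply: measurable_funM; last first.
    by apply: measurableT_comp => //; exact: measurable_fst.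
  apply: measurableT_comp => //; apply: measurable_funB.
    exact: measurable_fst.
  exact: measurable_snd.
have E1 t s : a <= t <= b -> kk (t - s) * ff t * gg s =
    ((fun u => f t * (k (t - u) * g u)) \_ `[a, t]) s.
  move=> tab; rewrite /kk /ff /gg !patchE !mem_setE !in_itv/= tab andbT subr_ge0.
  have [st|st] /= := leP s t; last by rewrite andbF !mul0r.
  have [as_|as_] /= := leP a s; last by rewrite mulr0.
  by case/andP : tab => _ tb; rewrite (le_trans st tb); ring.
have E2 t s : a <= s <= b -> kk (t - s) * ff t * gg s =
    ((fun u => g s * (k (u - s) * f u)) \_ `[s, b]) t.
  move=> sab; rewrite /kk /ff /gg !patchE !mem_setE !in_itv/= sab andbT subr_ge0.
  have [st|st] /= := leP s t; last by rewrite !mul0r.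
  have [tb|tb] /= := leP t b; last by rewrite andbF mulr0 mul0r.
  by case/andP : sab => as_ _; rewrite (le_trans as_ st)/=; ring.
have mkf' s : a <= s -> measurable_fun `[s, b] (fun t => k (t - s) * f t).
  move=> as_; apply: measurable_funM.
    by apply: measurable_funTS; apply: measurableT_comp => //; exact: measurable_funB.
  by apply: measurable_funS mf => //; apply: subset_itvr; rewrite bnd_simp.
have ikf s : a <= s <= b -> mu.-integrable `[s, b] (fun t => (k (t - s) * f t)%:E).
  move=> sab; apply: integrable_EFin_lt => //; first by apply: mkf'; case/andP : sab.
  apply: le_lt_trans (ltry K); apply: le_trans (fK _ sab).
  by under eq_integral do rewrite normrM ger0_norm//.
(* Tonelli: the integral in [t] comes first, because [fK] bounds it uniformly in [s]. *)
have Foo : (\int[mu]_s \int[mu]_t `|F (t, s)| < +oo)%E.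
  apply: (@le_lt_trans _ _ (\int[mu]_s (K%:E * `|(gg s)%:E|))%E); last first.
    rewrite ge0_integralZl//.
    - by rewrite lte_mul_pinfty ?lee_fin//; case/integrableP : ggi.
    - by apply: measurableT_comp => //; exact/measurable_EFinP.
  apply: ge0_le_integral => //.
  - by move=> s _; apply: integral_ge0.
  - apply: (measurable_fun_fubini_tonelli_G (m1 := mu) (abse \o F)) => //=.
    exact: measurableT_comp.
  - apply: measurable_funeM; apply: measurableT_comp => //; exact/measurable_EFinP.
  move=> s _.
  have [sab|sab] := boolP (a <= s <= b); last first.
    rewrite integral0_eq ?mule_ge0// => t _.
    rewrite /F/= /gg patchE mem_setE in_itv/= (negbTE sab) mulr0.
    by rewrite normr0.
  have -> : (fun t => `|F (t, s)|%E) =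
     (fun t => (`|g s|%:E * (k (t - s) * `|f t|)%:E)%E) \_ `[s, b].
    apply/funext => t; rewrite /F /= E2// !patchE; case: ifPn => _; last by rewrite normr0.
    by rewrite !normrM (ger0_norm (k0 _)).
  rewrite -integral_mkcond ge0_integralZl//; last first.
  - by move=> t _; rewrite lee_fin mulr_ge0.
  - apply/measurable_EFinP; apply: measurable_funM.
      by apply: measurable_funTS; apply: measurableT_comp => //; exact: measurable_funB.
    apply: measurableT_comp => //; apply: measurable_funS mf => //.
    by apply: subset_itvr; rewrite bnd_simp; case/andP : sab.
  rewrite muleC /gg patchE mem_setE in_itv/= sab.
  by rewrite lee_wpmul2r ?lee_fin// fK.
have Fint : (mu \x mu)%E.-integrable setT F by exact/integrable21ltyP.
have F2 s : a <= s <= b -> (\int[mu]_t F (t, s) =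
    (g s * \int[mu]_(t in `[s, b]) (k (t - s) * f t))%:E)%E.
  move=> sab; rewrite -RintegralZl//; last exact: ikf.
  rewrite /Rintegral fineK; last first.
    apply: integrable_fin_num => //.
    apply: (@integrable_EFinZl _ (g s) (fun u => k (u - s) * f u)) => //; exact: ikf.
  rewrite [RHS]integral_mkcond; apply: eq_integral => u _.
  by rewrite /F/= E2// !patchE; case: ifPn.
have F2' s : ~~ (a <= s <= b) -> (\int[mu]_t F (t, s) = 0)%E.
  move=> sab; apply: integral0_eq => t _; rewrite /F/= /gg patchE mem_setE in_itv/=.
  by rewrite (negbTE sab) mulr0.
have F2E : (fun s => (g s * \int[mu]_(t in `[s, b]) (k (t - s) * f t))%:E) \_ `[a, b] =
    (fun s => \int[mu]_t F (t, s))%E.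
  apply/funext => s; rewrite patchE mem_setE in_itv/=.
  by case: ifPn => [/F2|/F2'] ->.
split.
  apply/(integrable_mkcond _ _).2 => //; rewrite F2E; apply/integrableP; split.
    exact: measurable_fubini_G Fint.
  apply: le_lt_trans Foo.
  apply: ge0_le_integral => //.
  - by apply: measurableT_comp => //; exact: measurable_fubini_G Fint.
  - apply: (measurable_fun_fubini_tonelli_G (m1 := mu) (abse \o F)) => //=.
    exact: measurableT_comp.
  - move=> s _; apply: le_abse_integral => //.
    exact: (measurableT_comp mF (pair2_measurable s)).
move=> gik.
(* Pulling [f t] out of the inner integral uses its convergence at this very [t]; Fubini alone would
   give almost every [t]. *)
have F1 t : a <= t <= b -> (\int[mu]_s F (t, s) =
    (f t * \int[mu]_(s in `[a, t]) (k (t - s) * g s))%:E)%E.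
  move=> tab; rewrite -RintegralZl//; last exact: gik.
  rewrite /Rintegral fineK; last first.
    apply: integrable_fin_num => //.
    apply: (@integrable_EFinZl _ (f t) (fun u => k (t - u) * g u)) => //; exact: gik.
  rewrite [RHS]integral_mkcond; apply: eq_integral => u _.
  by rewrite /F/= E1// !patchE; case: ifPn.
have F1' t : ~~ (a <= t <= b) -> (\int[mu]_s F (t, s) = 0)%E.
  move=> tab; apply: integral0_eq => s _; rewrite /F/= /ff patchE mem_setE in_itv/=.
  by rewrite (negbTE tab) mulr0 mul0r.
have F1E : (fun t => (f t * \int[mu]_(s in `[a, t]) (k (t - s) * g s))%:E) \_ `[a, b] =
    (fun t => \int[mu]_s F (t, s))%E.
  apply/funext => t; rewrite patchE mem_setE in_itv/=.
  by case: ifPn => [/F1|/F1'] ->.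
rewrite /Rintegral integral_mkcond [in RHS]integral_mkcond F1E F2E.
by congr fine; exact: Fubini.
Qed.

Lemma integral_powR_le (ga s b : R) : 0 < ga -> s <= b ->
  (\int[mu]_(t in `[s, b]) ((t - s) `^ (ga - 1))%:E <= (ga^-1 * (b - s) `^ ga)%:E)%E.
Proof.
move=> ga0; rewrite le_eqVlt => /predU1P[<-|sb].
  by rewrite set_itv1 integral_set1 lee_fin mulr_ge0 ?invr_ge0 ?powR_ge0// ltW.
pose G t : R := ga^-1 * (t - s) `^ ga.
have mf (D : set R) : measurable_fun D (fun t : R => (t - s) `^ (ga - 1)).
  apply: measurable_funTS.
  have ms : measurable_fun setT (fun t : R => t - s) by exact: measurable_funB.
  exact: (measurableT_comp (measurable_powR (ga - 1)) ms).
have dG t : s < t -> is_derive t 1 G ((t - s) `^ (ga - 1)).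
  move=> st.
  have dp : is_derive (t - s) 1 (@powR R ^~ ga) (ga * (t - s) `^ (ga - 1)).
    by apply: is_derive1_powR; rewrite subr_gt0.
  have dsub : is_derive t 1 (fun u : R => u - s) 1.
    have := @is_deriveD _ _ _ id (cst (- s)) t 1 1 0 _ _.
    by rewrite addr0; apply.
  have := @is_deriveZ _ _ _ _ (ga^-1) _ _ _ (@is_derive1_comp _ (@powR R ^~ ga) (fun u => u - s) _ _ _ dp dsub).
  rewrite mulr1 /GRing.scale/= mulrA mulVf ?gt_eqF// mul1r.
  by apply.
have cG t : s < t -> {for t, continuous G}.
  move=> /dG[dGt _]; apply: differentiable_continuous.
  exact/derivable1_diffP.
have cf t : s < t -> {for t, continuous (fun u : R => (u - s) `^ (ga - 1))}.
  move=> st; apply: (@continuous_comp _ _ _ (fun u => u - s) (@powR R ^~ (ga - 1))).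
    by apply: cvgB; [exact: cvg_id|exact: cvg_cst].
  apply: differentiable_continuous; apply/derivable1_diffP.
  by apply: derivable_powR; rewrite in_itv/= andbT subr_gt0.
(* These points decrease from [b] (at n = 0) to [s] without reaching it. *)
pose c (n : nat) : R := s + (b - s) / n.+1%:R.
have sc n : s < c n by rewrite /c ltrDl divr_gt0// subr_gt0.
have cb n : c n <= b.
  rewrite /c -lerBrDl ler_pdivrMr// ler_peMr ?subr_ge0 ?(ltW sb)//.
  by rewrite ler1n.
have Fn n : (\int[mu]_(t in `[c n, b]) ((t - s) `^ (ga - 1))%:E <= (ga^-1 * (b - s) `^ ga)%:E)%E.
  have := cb n; rewrite le_eqVlt => /predU1P[<-|cnb].
    by rewrite set_itv1 integral_set1 lee_fin mulr_ge0 ?invr_ge0 ?powR_ge0// ltW.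
  rewrite (@continuous_FTC2 _ _ G)//.
  - by rewrite -EFinB lee_fin /G gerBl// mulr_ge0 ?invr_ge0 ?powR_ge0// ltW.
  - apply/continuous_within_itvP => //; split.
    + by move=> t; rewrite in_itv/= => /andP[ct _]; apply: cf; exact: lt_trans ct.
    + by apply: cvg_at_right_filter; exact: cf.
    + by apply: cvg_at_left_filter; exact: cf.
  - split.
    + move=> t; rewrite in_itv/= => /andP[ct _].
      by have [] := dG t (lt_trans (sc n) ct).
    + by apply: cvg_at_right_filter; exact: cG.
    + by apply: cvg_at_left_filter; exact: cG.
  - move=> t; rewrite in_itv/= => /andP[ct _].
    by rewrite derive1E; have [_] := dG t (lt_trans (sc n) ct).
rewrite -integral_itv_obnd_cbnd; last exact/measurable_EFinP.
have -> : (`]s, b] = \bigcup_n `[c n, b])%classic.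
  apply/seteqP; split=> [t|t [n _]]; rewrite /= !in_itv/=; last first.
    by case/andP => /(lt_le_trans (sc n)) -> ->.
  case/andP => st tb.
  (* This index satisfies n + 1 > (b - s) / (t - s), that is, [c n < t]. *)
  exists (Num.truncn ((b - s) / (t - s))) => //=; rewrite in_itv/= tb andbT.
  rewrite /c -lerBrDl ler_pdivrMr// mulrC -ler_pdivrMr ?subr_gt0//.
  exact/ltW/truncnS_gt.
have cvgI : (\int[mu]_(t in `[c n, b]) ((t - s) `^ (ga - 1))%:E)%E @[n --> \oo] -->
    (\int[mu]_(t in \bigcup_n `[c n, b]%classic) ((t - s) `^ (ga - 1))%:E)%E.
  apply: ge0_nondecreasing_set_cvg_integral => //.
  - move=> n m nm; apply/subsetPset; apply: subset_itvr; rewrite bnd_simp.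
    rewrite lerD2l ler_wpM2l ?subr_ge0 ?(ltW sb)// lef_pV2 ?posrE ?ltr0n//.
    by rewrite ler_nat.
  - by move=> n; have /measurable_EFinP := mf `[c n, b]%classic.
  - by move=> n t _; rewrite lee_fin powR_ge0.
rewrite -(cvg_lim _ cvgI)//; apply: lime_le; first by apply/cvg_ex; eexists; exact: cvgI.
exact: nearW.
Qed.
End Volterra.

(** * Continuity and derivatives on a segment *)

Section Calculus.
Variable R : realType.
Implicit Types (f g : R -> R) (a b s t M e : R).

Lemma derivable_increment_le f s s0 e M :
  (forall c, derivable f c 1) -> (forall c, `|c - s0| < e -> `|derive1 f c| <= M) ->
  `|s - s0| < e -> `|f s - f s0| <= M * `|s - s0|.
Proof.
move=> df fM se.
have fc i : {within [set` i : interval R], continuous f}.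
  by apply: derivable_within_continuous.
have isd (c : R) : is_derive c 1 f (derive1 f c) by apply: DeriveDef; rewrite ?derive1E.
have [s0s|ss0] := leP s0 s.
  have [c] := @MVT_segment _ _ (derive1 f) _ _ s0s (fun c _ => isd c) (fc _).
  rewrite in_itv/= => /andP[s0c cs] ->; rewrite normrM ler_wpM2r// fM//.
  by apply: le_lt_trans se; rewrite !ger0_norm ?subr_ge0// lerD2r.
have [c] := @MVT_segment _ _ (derive1 f) _ _ (ltW ss0) (fun c _ => isd c) (fc _).
rewrite in_itv/= distrC => /andP[sc cs0] ->.
rewrite normrM (distrC s) ler_wpM2r// fM//.
apply: le_lt_trans se; rewrite distrC (distrC s) !ger0_norm ?subr_ge0//.
  by rewrite lerD2l lerN2.
exact: ltW.
Qed.

(* Iterated over the variables, this gives continuity from continuous partial derivatives. *)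
Lemma continuous_last_partial (U : topologicalType) (F : U -> R -> R) :
  (forall s, continuous (F ^~ s)) -> (forall u s, derivable (F u) s 1) ->
  continuous (fun p : U * R => derive1 (F p.1) p.2) ->
  continuous (fun p : U * R => F p.1 p.2).
Proof.
move=> Fc dF Dc [u0 s0]; apply/cvgrPdist_lt => /= eps eps0.
pose M := `|derive1 (F u0) s0| + 1.
have M0 : 0 < M by rewrite ltr_wpDl.
have /cvgrPdist_lt/(_ 1 ltr01) := Dc (u0, s0).
move=> [/= [A B] [/= nA nB] AB].
have /nbhs_ballP[e /= e0 eB] := nB.
have DM u s : A u -> `|s - s0| < e -> `|derive1 (F u) s| <= M.
  move=> Au se; have /= := AB (u, s) (conj Au (eB s _)); rewrite /ball/= distrC.
  move=> /(_ se); rewrite -[X in _ -> `|X| <= _](subrK (derive1 (F u0) s0)) => H.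
  rewrite (le_trans (ler_normD _ _))// addrC lerD2l distrC; exact: ltW.
have /cvgrPdist_lt/(_ (eps / 2)) := Fc s0 u0; rewrite divr_gt0// => /(_ isT) nF.
have em0 : 0 < Num.min e (eps / 2 / M) by rewrite lt_min e0 !divr_gt0.
exists (A `&` [set u | `|F u0 s0 - F u s0| < eps / 2], ball s0 (Num.min e (eps / 2 / M))) => /=.
  by split; [exact: filterI|exact: nbhsx_ballx].
move=> [u s] /= [[Au Fu]]; rewrite /ball/= distrC lt_min => /andP[se sM].
(* Triangle inequality through [F u s0]: one half of [eps] is paid by continuity in [u] at [s0], the
   other by the mean value bound in [s]. *)
rewrite -[X in `|X| < _](subrKA (F u s0)) (le_lt_trans (ler_normD _ _))//.
rewrite [ltRHS](splitr eps) ltr_leD// distrC.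
rewrite (le_trans (derivable_increment_le (dF u) (fun c => DM u c Au) se))//.
by rewrite mulrC -ler_pdivlMr// ltW.
Qed.

Lemma continuous_pair1 (U V W : topologicalType) (G : U * V -> W) v0 :
  continuous G -> continuous (fun u => G (u, v0)).
Proof.
move=> Gc u; apply: (@continuous_comp _ _ _ (fun u => (u, v0)) G); last exact: Gc.
by apply: cvg_pair; [exact: cvg_id|exact: cvg_cst].
Qed.

(** [C1_4] asserts joint continuity of the partial derivatives only. That of [l] follows by freeing
    one variable at a time, starting from differentiability in [t]. *)
Lemma C1_4_continuous (l : R -> R -> R -> R -> R) : C1_4 l ->
  continuous (fun p : R * R * R * R => l p.1.1.1 p.1.1.2 p.1.2 p.2).
Proof.
move=> [dl [c1 c2 c3 c4]].
apply: (@continuous_last_partial _ (fun (u : R * R * R) s => l u.1.1 u.1.2 u.2 s)); last 2 first.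
- by move=> u s; have [_ _ _ d] := dl u.1.1 u.1.2 u.2 s; exact: d.
- exact: c4.
move=> w; apply: (@continuous_last_partial _ (fun (u : R * R) s => l u.1 u.2 s w)); last 2 first.
- by move=> u s; have [_ _ d _] := dl u.1 u.2 s w; exact: d.
- exact: (@continuous_pair1 _ _ _
    (fun p : R * R * R * R => pd4_3 l p.1.1.1 p.1.1.2 p.1.2 p.2) w c3).
move=> v; apply: (@continuous_last_partial _ (fun u s => l u s v w)); last 2 first.
- by move=> u s; have [_ d _ _] := dl u s v w; exact: d.
- have c2w := @continuous_pair1 _ _ _
    (fun p : R * R * R * R => pd4_2 l p.1.1.1 p.1.1.2 p.1.2 p.2) w c2.
  exact: (@continuous_pair1 _ _ _
    (fun p : R * R * R => pd4_2 l p.1.1 p.1.2 p.2 w) v c2w).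
move=> x t; apply: differentiable_continuous; apply/derivable1_diffP.
by have [d _ _ _] := dl t x v w; exact: d.
Qed.

Lemma C1_5_continuous (L : R -> R -> R -> R -> R -> R) : C1_5 L ->
  continuous (fun p : R * R * R * R * R => L p.1.1.1.1 p.1.1.1.2 p.1.1.2 p.1.2 p.2).
Proof.
move=> [dL [c1 c2 c3 c4 c5]].
apply: (@continuous_last_partial _
  (fun (u : R * R * R * R) s => L u.1.1.1 u.1.1.2 u.1.2 u.2 s)); last 2 first.
- by move=> u s; have [_ _ _ _ d] := dL u.1.1.1 u.1.1.2 u.1.2 u.2 s; exact: d.
- exact: c5.
(* With [z] frozen, [L] is a [C1_4] function of the other four variables. *)
move=> z; apply: (@C1_4_continuous (fun t x v w => L t x v w z)); split.
  by move=> t x v w; have [d1 d2 d3 d4 _] := dL t x v w z; split; [exact: d1|exact: d2|exact: d3|exact: d4].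
split.
- exact: (@continuous_pair1 _ _ _
    (fun p : R * R * R * R * R => pd5_1 L p.1.1.1.1 p.1.1.1.2 p.1.1.2 p.1.2 p.2) z c1).
- exact: (@continuous_pair1 _ _ _
    (fun p : R * R * R * R * R => pd5_2 L p.1.1.1.1 p.1.1.1.2 p.1.1.2 p.1.2 p.2) z c2).
- exact: (@continuous_pair1 _ _ _
    (fun p : R * R * R * R * R => pd5_3 L p.1.1.1.1 p.1.1.1.2 p.1.1.2 p.1.2 p.2) z c3).
- exact: (@continuous_pair1 _ _ _
    (fun p : R * R * R * R * R => pd5_4 L p.1.1.1.1 p.1.1.1.2 p.1.1.2 p.1.2 p.2) z c4).
Qed.

Lemma within_continuous_pair (U V : topologicalType) (D : set R)
    (f : R -> U) (g : R -> V) :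
  {within D, continuous f} -> {within D, continuous g} ->
  {within D, continuous (fun t => (f t, g t))}.
Proof. by move=> fc gc t; apply: cvg_pair; [exact: fc|exact: gc]. Qed.

Lemma within_continuous_comp (U V : topologicalType) (D : set R)
    (f : R -> U) (G : U -> V) :
  {within D, continuous f} -> continuous G -> {within D, continuous (G \o f)}.
Proof. by move=> fc Gc t; apply: (@continuous_comp (subspace D) U V f G t); [exact: fc|exact: Gc]. Qed.

Lemma within_continuousD (D : set R) f g :
  {within D, continuous f} -> {within D, continuous g} ->
  {within D, continuous (fun t => f t + g t)}.
Proof. by move=> fc gc t; apply: cvgD; [exact: fc|exact: gc]. Qed.

Lemma within_continuousB (D : set R) f g :
  {within D, continuous f} -> {within D, continuous g} ->
  {within D, continuous (fun t => f t - g t)}.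
Proof. by move=> fc gc t; apply: cvgB; [exact: fc|exact: gc]. Qed.

Lemma within_continuousM (D : set R) f g :
  {within D, continuous f} -> {within D, continuous g} ->
  {within D, continuous (fun t => f t * g t)}.
Proof. by move=> fc gc t; apply: cvgM; [exact: fc|exact: gc]. Qed.

(** At an interior point the constraint a <= t + h <= b holds for all small [h], so the filter of
    [deriv_in] is the punctured neighbourhood filter of 0. *)
Lemma derivable_in_interior a b f t : a < t < b -> derivable_in a b f t ->
  is_derive t 1 f (deriv_in a b f t).
Proof.
move=> /andP[at_ tb]; rewrite /derivable_in /deriv_in.
have -> : within (within_ab a b t) (nbhs (0 : R)) = 0^'.
  apply/seteqP; split=> A.
    rewrite /dnbhs /within /= => nA.
    have near_ab : \forall h \near (0 : R), a <= t + h <= b.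
      near=> h.
      have : `|0 - h| < Num.min (t - a) (b - t).
        by near: h; apply: cvgr_dist_lt => //; rewrite lt_min !subr_gt0 at_.
      by rewrite sub0r normrN lt_min !ltr_norml; lra.
    near=> h => h0; apply: (near nA h) => //.
    by split => //; apply: (near near_ab h).
  rewrite /dnbhs /within /= => nA; near=> h => -[h0 _].
  by apply: (near nA h).
have -> : dquot f t = (fun h => h^-1 *: ((f \o shift t) (h *: 1) - f t)).
  apply/funext => h; rewrite /dquot /=; congr (_ * (f _ - _)).
  by rewrite /GRing.scale/= mulr1 addrC.
by move=> dft; split.
Unshelve. all: by end_near. Qed.

Lemma derivable_in_continuous a b f :
  (forall t, a <= t <= b -> derivable_in a b f t) ->
  {within `[a, b], continuous f}.
Proof.
move=> df; apply/subspace_continuousP => t tabE.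
have tab : a <= t <= b by move: tabE; rewrite /= in_itv.
(* Within distance [e] of [t] the difference quotient is at most |l| + 1 in absolute value, so [f]
   satisfies a Lipschitz estimate at [t], end points included. *)
have /cvg_ex[l /cvgrPdist_lt/(_ 1 ltr01)/nbhs_ballP[e /= e0 eB]] := df t tab.
apply/cvgrPdist_lt => eps eps0.
have l0 : 0 < `|l| + 1 by rewrite ltr_wpDl.
have em0 : 0 < Num.min e (eps / (`|l| + 1)) by rewrite lt_min e0 !divr_gt0.
apply/nbhs_ballP; exists (Num.min e (eps / (`|l| + 1))) => //= u.
rewrite /ball/= lt_min => /andP[ue ul]; rewrite in_itv/= => uab.
have [->|ut] := eqVneq u t; first by rewrite subrr normr0.
have ut0 : u - t != 0 by rewrite subr_eq0.
have := eB (u - t); rewrite /ball/= sub0r opprB => /(_ ue).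
rewrite /within_ab/= /dquot [t + _]addrC subrK => /(_ (conj ut0 uab)) dq.
have {}dq : `|(u - t)^-1 * (f u - f t)| <= `|l| + 1.
  rewrite -[X in `|X|](subrK l) (le_trans (ler_normD _ _))// addrC lerD2l.
  by rewrite distrC ltW.
rewrite normrM normfV ler_pdivrMl ?normr_gt0// in dq.
rewrite /from_subspace distrC; apply: (le_lt_trans dq).
by rewrite -ltr_pdivlMr// distrC.
Qed.
End Calculus.

(** * Integration by parts *)

Section ByParts.
Variable R : realType.
Notation mu := (@lebesgue_measure R).
Implicit Types (f g h x q Q : R -> R) (a b s t M : R).

Lemma within_continuous_integrable a b f : {within `[a, b], continuous f} ->
  mu.-integrable `[a, b] (EFin \o f).
Proof. by move=> fc; apply: continuous_compact_integrable => //; exact: segment_compact. Qed.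

Lemma within_continuous_measurable a b f : {within `[a, b], continuous f} ->
  measurable_fun `[a, b] f.
Proof. by move/within_continuous_integrable/integrableP => [/measurable_EFinP]. Qed.

Lemma within_continuous_bounded a b f : a <= b -> {within `[a, b], continuous f} ->
  exists2 M, 0 <= M & forall t, a <= t <= b -> `|f t| <= M.
Proof.
move=> ab fc.
have [c _ fM] := EVT_max ab (within_continuous_comp fc (@norm_continuous R R)).
by exists `|f c| => // t tab; apply: fM; rewrite in_itv.
Qed.

Lemma Rintegral_itv_scale a b (c : R) f : mu.-integrable `[a, b] (EFin \o f) ->
  \int[mu]_(t in `[a, b]) (c * f t) = c * \int[mu]_(t in `[a, b]) f t.
Proof. by move=> fi; rewrite RintegralZl. Qed.

Lemma Rintegral_itv_add a b f g : mu.-integrable `[a, b] (EFin \o f) ->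
  mu.-integrable `[a, b] (EFin \o g) ->
  \int[mu]_(t in `[a, b]) (f t + g t) =
  \int[mu]_(t in `[a, b]) f t + \int[mu]_(t in `[a, b]) g t.
Proof. by move=> fi gi; rewrite RintegralD. Qed.

Lemma Rintegral_itv_sub a b f g : mu.-integrable `[a, b] (EFin \o f) ->
  mu.-integrable `[a, b] (EFin \o g) ->
  \int[mu]_(t in `[a, b]) (f t - g t) =
  \int[mu]_(t in `[a, b]) f t - \int[mu]_(t in `[a, b]) g t.
Proof. by move=> fi gi; rewrite RintegralB. Qed.

Lemma integrable_itv_scale a b (c : R) f : mu.-integrable `[a, b] (EFin \o f) ->
  mu.-integrable `[a, b] (EFin \o (fun t => c * f t)).
Proof. exact: integrable_EFinZl. Qed.

Lemma integrable_bounded_mul (D : set R) h g M : measurable D -> measurable_fun D h ->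
  (forall t, D t -> `|h t| <= M) -> mu.-integrable D (EFin \o g) ->
  mu.-integrable D (EFin \o (fun t => h t * g t)).
Proof.
move=> mD mh hM gi.
have hb : [bounded h t | t in D].
  exists M; split; first exact: num_real.
  by move=> N MN t Dt /=; rewrite (le_trans (hM t Dt))// ltW.
by have := @integrableMr _ _ _ mu D mD _ _ mh hb gi; apply: eq_integrable.
Qed.

Lemma integrable_continuous_mul a b h g : a <= b -> {within `[a, b], continuous h} ->
  mu.-integrable `[a, b] (EFin \o g) ->
  mu.-integrable `[a, b] (EFin \o (fun t => h t * g t)).
Proof.
move=> ab hc; have [M _ hM] := within_continuous_bounded ab hc.
apply: (@integrable_bounded_mul _ _ _ M) => //.
  exact: within_continuous_measurable.
Qed.

(** The end points are null, so agreement inside the segment suffices; this fits derivatives, which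
    are controlled only there. *)
Lemma integral_ae_eq_itv a b f g : measurable_fun `[a, b] f ->
  measurable_fun `[a, b] g ->
  {ae mu, forall t, a < t < b -> f t = g t} ->
  (\int[mu]_(t in `[a, b]) (f t)%:E = \int[mu]_(t in `[a, b]) (g t)%:E)%E.
Proof.
have sub : `]a, b[ `<=` `[a, b] by apply: subset_itv; rewrite bnd_simp.
have E h : measurable_fun `[a, b] h ->
    (\int[mu]_(t in `[a, b]) (h t)%:E = \int[mu]_(t in `]a, b[) (h t)%:E)%E.
  move=> mh; rewrite -integral_itv_bndo_bndc; last first.
    by apply/measurable_EFinP; apply: measurable_funS mh => //; apply: subset_itvl; rewrite bnd_simp.
  rewrite -integral_itv_obnd_cbnd//.
  by apply/measurable_EFinP; apply: measurable_funS mh.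
move=> mf mg fg; rewrite !E//; apply: ae_eq_integral => //.
- by apply/measurable_EFinP; apply: measurable_funS mf.
- by apply/measurable_EFinP; apply: measurable_funS mg.
- move: fg; apply: filterS; first exact: (ae_filter_ringOfSetsType mu).
  by move=> t fg; rewrite /= in_itv/= => tab; rewrite fg.
Qed.

Lemma integrable_ae_eq_itv a b f g : measurable_fun `[a, b] f ->
  mu.-integrable `[a, b] (EFin \o g) ->
  {ae mu, forall t, a < t < b -> f t = g t} ->
  mu.-integrable `[a, b] (EFin \o f).
Proof.
move=> mf /integrableP[/measurable_EFinP mg goo] fg.
apply: integrable_EFin_lt => //.
rewrite (@integral_ae_eq_itv _ _ _ (fun t => `|g t|))//.
- exact: measurableT_comp.
- exact: measurableT_comp.
- move: fg; apply: filterS; first exact: (ae_filter_ringOfSetsType mu).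
  by move=> t fg tab; rewrite fg.
Qed.

Lemma abs_cont_on_continuous a b x : a <= b -> abs_cont_on a b x ->
  {within `[a, b], continuous x}.
Proof.
move=> ab /(abs_cont_clamp ab)/abs_cont_continuous xc.
apply: (@subspace_eq_continuous _ _ _ (x \o clamp a b)).
  by move=> t; rewrite inE /= in_itv/= => tab; rewrite clamp_id.
exact: continuous_subspaceT.
Qed.

Lemma lipschitz_abs_cont_on a b M x :
  (forall s t, a <= s -> s <= t -> t <= b -> `|x t - x s| <= M * (t - s)) ->
  abs_cont_on a b x.
Proof.
move=> xM eps eps0; have M0 : 0 < `|M| + 1 by rewrite ltr_wpDl.
exists (eps / (`|M| + 1)); first by rewrite divr_gt0.
move=> n c d cd _ sdel.
apply: (@le_lt_trans _ _ ((`|M| + 1) * \sum_(i < n) (d i - c i))); last first.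
  by rewrite mulrC -ltr_pdivlMr.
rewrite mulr_sumr; apply: ler_sum => i _; have [ac [cd' db]] := cd i.
rewrite (le_trans (xM _ _ ac cd' db))// ler_wpM2r ?subr_ge0//.
by rewrite (le_trans (ler_norm M))// lerDl.
Qed.

Lemma derivative_bounded_abs_cont_on a b Q q M : {within `[a, b], continuous Q} ->
  (forall t, a < t < b -> is_derive t 1 Q (q t)) ->
  (forall t, a < t < b -> `|q t| <= M) -> abs_cont_on a b Q.
Proof.
move=> Qc dQ qM; apply: (@lipschitz_abs_cont_on _ _ M) => s t as_ st tb.
move: st; rewrite le_eqVlt => /predU1P[->|st]; first by rewrite !subrr normr0 mulr0.
have sub c : s < c < t -> a < c < b.
  by move=> /andP[sc ct]; rewrite (le_lt_trans as_ sc) (lt_le_trans ct tb).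
have [||c ct ->] := @MVT _ Q q _ _ st.
- by move=> c; rewrite in_itv/= => /sub; exact: dQ.
- by apply: continuous_subspaceW Qc; apply: subset_itv; rewrite bnd_simp.
- rewrite normrM (gtr0_norm (_ : 0 < t - s)) ?subr_gt0//.
  by rewrite ler_wpM2r ?subr_ge0 ?(ltW st)// qM// sub//; rewrite in_itv in ct.
Qed.

(** The case of the constant kernel 1 in [Volterra_Fubini], with [K] the integral of |f|. *)
Lemma triangle_Fubini a b f g : mu.-integrable `[a, b] (EFin \o f) ->
  mu.-integrable `[a, b] (EFin \o g) ->
  \int[mu]_(t in `[a, b]) (f t * \int[mu]_(s in `[a, t]) g s) =
  \int[mu]_(s in `[a, b]) (g s * \int[mu]_(t in `[s, b]) f t).
Proof.
move=> fi gi.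
have mf : measurable_fun `[a, b] f by case/integrableP : fi => /measurable_EFinP.
pose K := \int[mu]_(t in `[a, b]) `|f t|.
have K0 : 0 <= K by apply: Rintegral_ge0.
have hK s : a <= s <= b -> (\int[mu]_(t in `[s, b]) (1 * `|f t|)%:E <= K%:E)%E.
  move=> /andP[as_ sb]; under eq_integral do rewrite mul1r.
  rewrite /K /Rintegral fineK; last first.
    apply: integrable_fin_num => //.
    by have := integrable_abse fi; apply: eq_integrable.
  apply: ge0_subset_integral => //.
  - by apply/measurable_EFinP; apply: measurableT_comp.
  - by apply: subset_itvr; rewrite bnd_simp.
have [_ H] := @Volterra_Fubini R a b (fun=> 1) f g K K0 (measurable_cst _)
  (fun=> ler01) mf gi hK.
transitivity (\int[mu]_(t in `[a, b]) (f t * \int[mu]_(s in `[a, t]) (1 * g s))).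
  by apply: eq_Rintegral => t _; under [in RHS]eq_Rintegral do rewrite mul1r.
rewrite H; last first.
  move=> t /andP[at_ tb].
  have : mu.-integrable `[a, t] (EFin \o g).
    by apply: integrableS gi => //; apply: subset_itvl; rewrite bnd_simp.
  by apply: eq_integrable => // s _; rewrite /= mul1r.
by apply: eq_Rintegral => s _; under [in LHS]eq_Rintegral do rewrite mul1r.
Qed.

(** [Q] is Lipschitz because [q] is bounded, so both [x] and [Q] are integrals of densities [g] and
    [r]; the formula is Fubini on a triangle for [r] and [g]. *)
Lemma abs_cont_by_parts a b x Q q M : a < b -> abs_cont_on a b x ->
  measurable_fun `[a, b] (derive1 x) -> {within `[a, b], continuous Q} ->
  (forall t, a < t < b -> is_derive t 1 Q (q t)) ->
  (forall t, a < t < b -> `|q t| <= M) -> measurable_fun `[a, b] q ->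
  mu.-integrable `[a, b] (EFin \o derive1 x) /\
  \int[mu]_(t in `[a, b]) (derive1 x t * Q t) =
  x b * Q b - x a * Q a - \int[mu]_(t in `[a, b]) (q t * x t).
Proof.
move=> ab xac mx' Qc dQ qM mq; have ab' := ltW ab.
have [g [gi gE gae]] := abs_cont_on_density ab' xac.
have [r [ri rE rae]] := abs_cont_on_density ab' (derivative_bounded_abs_cont_on Qc dQ qM).
have giab : mu.-integrable `[a, b] (EFin \o g) by apply: integrableS gi.
have riab : mu.-integrable `[a, b] (EFin \o r) by apply: integrableS ri.
have mg : measurable_fun `[a, b] g by case/integrableP : giab => /measurable_EFinP.
have mr : measurable_fun `[a, b] r by case/integrableP : riab => /measurable_EFinP.
have xg : {ae mu, forall t, a < t < b -> derive1 x t = g t}.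
  move: gae; apply: filterS; first exact: (ae_filter_ringOfSetsType mu).
  by move=> t H /H[].
have qr : {ae mu, forall t, a < t < b -> q t = r t}.
  move: rae; apply: filterS; first exact: (ae_filter_ringOfSetsType mu).
  move=> t H tab; have [_ <-] := H tab.
  by have [_] := dQ t tab; rewrite derive1E => ->.
have xc := abs_cont_on_continuous ab' xac.
have mx := within_continuous_measurable xc.
have mQ := within_continuous_measurable Qc.
split; first exact: integrable_ae_eq_itv xg.
have irx : mu.-integrable `[a, b] (EFin \o (fun t => r t * x t)).
  have := integrable_continuous_mul ab' xc riab.
  by apply: eq_integrable => // t _; rewrite /= mulrC.
have igQ : mu.-integrable `[a, b] (EFin \o (fun t => g t * Q t)).
  have := integrable_continuous_mul ab' Qc giab.
  by apply: eq_integrable => // t _; rewrite /= mulrC.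
have aab : a <= b <= b by rewrite ab' lexx.
have Lr : \int[mu]_(t in `[a, b]) (r t * (x t - x a)) =
    \int[mu]_(t in `[a, b]) (r t * x t) - x a * (Q b - Q a).
  rewrite (rE _ aab) -(Rintegral_itv_scale _ riab).
  rewrite -(Rintegral_itv_sub irx (integrable_itv_scale _ riab)).
  by apply: eq_Rintegral => t _; ring.
have Lg : \int[mu]_(t in `[a, b]) (g t * (Q b - Q t)) =
    Q b * (x b - x a) - \int[mu]_(t in `[a, b]) (g t * Q t).
  rewrite (gE _ aab) -(Rintegral_itv_scale _ giab).
  rewrite -(Rintegral_itv_sub (integrable_itv_scale _ giab) igQ).
  by apply: eq_Rintegral => t _; ring.
(* Both sides equal the integral of [r t * g s] over a <= s <= t <= b; [Lr] and [Lg] expand them. *)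
have E : \int[mu]_(t in `[a, b]) (r t * (x t - x a)) =
         \int[mu]_(t in `[a, b]) (g t * (Q b - Q t)).
  transitivity (\int[mu]_(t in `[a, b]) (r t * \int[mu]_(s in `[a, t]) g s)).
    by apply: eq_Rintegral => t; rewrite inE /= in_itv/= => tab; rewrite -gE.
  rewrite (triangle_Fubini riab giab).
  apply: eq_Rintegral => s; rewrite inE /= in_itv/= => sab.
  have /andP[as_ sb] := sab.
  have := @Rintegral_itvB R r (BLeft a) (BRight b) s riab.
  rewrite !bnd_simp => /(_ as_ sb).
  rewrite -(rE _ aab) -(rE _ sab) Rintegral_itv_obnd_cbnd; last first.
    by apply: integrableS riab => //; apply: subset_itvr; rewrite bnd_simp.
  by move=> <-; ring.
move: E; rewrite Lr Lg.
(* The densities are now replaced by [q] and [derive1 x], to which they are equal almost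
   everywhere. *)
have -> : \int[mu]_(t in `[a, b]) (r t * x t) = \int[mu]_(t in `[a, b]) (q t * x t).
  congr fine; apply: integral_ae_eq_itv.
  - exact: measurable_funM.
  - exact: measurable_funM.
  - move: qr; apply: filterS; first exact: (ae_filter_ringOfSetsType mu).
    by move=> t fg tab; rewrite fg.
have -> : \int[mu]_(t in `[a, b]) (g t * Q t) = \int[mu]_(t in `[a, b]) (derive1 x t * Q t).
  congr fine; apply: integral_ae_eq_itv.
  - exact: measurable_funM.
  - exact: measurable_funM.
  - move: xg; apply: filterS; first exact: (ae_filter_ringOfSetsType mu).
    by move=> t fg tab; rewrite fg.
move: (\int[mu]_(t in _) (q t * x t)) (\int[mu]_(t in _) (derive1 x t * Q t)) => X Y XY.
by move: XY; clear => XY; lra.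
Qed.
End ByParts.

(** * Fractional kernels and the vanishing of the pairing *)

Section Pairing.
Variable R : realType.
Notation mu := (@lebesgue_measure R).
Implicit Types (f g h u A B C p : R -> R) (a b c s t M ga al be : R).

Lemma kernel_bound ga a b f : 0 < ga -> a <= b -> {within `[a, b], continuous f} ->
  exists2 K : R, 0 <= K & forall s, a <= s <= b ->
    (\int[mu]_(t in `[s, b]) ((t - s) `^ (ga - 1) * `|f t|)%:E <= K%:E)%E.
Proof.
move=> ga0 ab fc; have [M M0 fM] := within_continuous_bounded ab fc.
exists (M * (ga^-1 * (b - a) `^ ga)).
  by rewrite !mulr_ge0 ?invr_ge0 ?powR_ge0// ltW.
move=> s /andP[as_ sb].
have mk (D : set R) : measurable_fun D (fun t : R => (t - s) `^ (ga - 1)).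
  apply: measurable_funTS.
  have ms : measurable_fun setT (fun t : R => t - s) by exact: measurable_funB.
  exact: (measurableT_comp (measurable_powR (ga - 1)) ms).
have mf : measurable_fun `[s, b] f.
  apply: measurable_funS (within_continuous_measurable fc) => //.
  by apply: subset_itvr; rewrite bnd_simp.
apply: (@le_trans _ _ (\int[mu]_(t in `[s, b]) (M%:E * ((t - s) `^ (ga - 1))%:E))%E).
  apply: ge0_le_integral => //.
  - by move=> t _; rewrite lee_fin mulr_ge0// powR_ge0.
  - by apply/measurable_EFinP; apply: measurable_funM; [exact: mk|exact: measurableT_comp].
  - by apply/measurable_EFinP; apply: measurable_funM; [exact: measurable_cst|exact: mk].
  - move=> t; rewrite /= in_itv/= => /andP[st tb].
    by rewrite -EFinM lee_fin mulrC ler_wpM2r ?powR_ge0// fM// (le_trans as_ st).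
rewrite ge0_integralZl//; last first.
- by move=> t _; rewrite lee_fin powR_ge0.
- by have /measurable_EFinP := mk `[s, b]%classic.
rewrite EFinM lee_wpmul2l ?lee_fin//.
apply: (le_trans (integral_powR_le ga0 sb)).
rewrite lee_fin ler_wpM2l ?invr_ge0 ?(ltW ga0)//.
by rewrite ge0_ler_powR ?nnegrE ?subr_ge0 ?(ltW ga0)// ?(le_trans as_)// lerD2l lerN2.
Qed.

Lemma kernel_integrable ga a b f : 0 < ga -> a <= b -> {within `[a, b], continuous f} ->
  forall s, a <= s <= b ->
    mu.-integrable `[s, b] (EFin \o (fun t => (t - s) `^ (ga - 1) * f t)).
Proof.
move=> ga0 ab fc s sab; have [K K0 fK] := kernel_bound ga0 ab fc.
apply: integrable_EFin_lt => //.
  apply: measurable_funM.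
    apply: measurable_funTS.
    have ms : measurable_fun setT (fun t : R => t - s) by exact: measurable_funB.
    exact: (measurableT_comp (measurable_powR (ga - 1)) ms).
  apply: measurable_funS (within_continuous_measurable fc) => //.
  by apply: subset_itvr; rewrite bnd_simp; case/andP : sab.
apply: le_lt_trans (ltry K); apply: le_trans (fK s sab).
by under eq_integral do rewrite normrM ger0_norm ?powR_ge0//.
Qed.

Lemma kernel_potential_bounded ga a b f : 0 < ga -> a <= b ->
  {within `[a, b], continuous f} -> exists M, forall s, a <= s <= b ->
    `|\int[mu]_(t in `[s, b]) ((t - s) `^ (ga - 1) * f t)| <= M.
Proof.
move=> ga0 ab fc; have [K K0 fK] := kernel_bound ga0 ab fc.
exists K => s sab; rewrite -lee_fin.
have ki := kernel_integrable ga0 ab fc sab.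
rewrite EFin_normr_Rintegral//.
apply: le_trans (fK s sab); apply: le_trans (le_abse_integral _ _ _) _ => //.
  by case/integrableP : ki.
by under eq_integral do rewrite /= normrM ger0_norm ?powR_ge0//.
Qed.

(** Fractional integration by parts, with [c] standing for the factor 1 / Gamma. [g] is merely
    integrable so that it can be the derivative of an absolutely continuous function. *)
Lemma fractional_Fubini ga a b c f g : 0 < ga -> a <= b ->
  {within `[a, b], continuous f} -> mu.-integrable `[a, b] (EFin \o g) ->
  let I s := c * \int[mu]_(t in `[s, b]) ((t - s) `^ (ga - 1) * f t) in
  mu.-integrable `[a, b] (EFin \o (fun s => g s * I s)) /\
  ((forall t, a <= t <= b ->
     mu.-integrable `[a, t] (fun s => ((t - s) `^ (ga - 1) * g s)%:E)) ->
   \int[mu]_(t in `[a, b])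
     (f t * (c * \int[mu]_(s in `[a, t]) ((t - s) `^ (ga - 1) * g s))) =
   \int[mu]_(s in `[a, b]) (g s * I s)).
Proof.
move=> ga0 ab fc gi I.
have cfc : {within `[a, b], continuous (fun t => c * f t)}.
  by apply: within_continuousM => //; move=> t; exact: cvg_cst.
have [K K0 fK] := kernel_bound ga0 ab cfc.
have [i1 H] := @Volterra_Fubini R a b (fun s => s `^ (ga - 1)) (fun t => c * f t) g K
  K0 (measurable_powR _) (fun s => powR_ge0 _ _) (within_continuous_measurable cfc) gi fK.
have IE s : a <= s <= b ->
    \int[mu]_(t in `[s, b]) ((t - s) `^ (ga - 1) * (c * f t)) = I s.
  move=> sab; rewrite /I -Rintegral_itv_scale; last exact: (kernel_integrable ga0 ab fc).
  by apply: eq_Rintegral => t _; ring.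
split.
  apply: eq_integrable i1 => // s; rewrite inE /= in_itv/= => sab.
  by rewrite IE.
move=> /H {}H; transitivity (\int[mu]_(t in `[a, b]) (c * f t *
    \int[mu]_(s in `[a, t]) ((t - s) `^ (ga - 1) * g s))).
  by apply: eq_Rintegral => t _; ring.
rewrite H; apply: eq_Rintegral => s; rewrite inE /= in_itv/= => sab.
by rewrite IE.
Qed.

Lemma Caputo_derive1_measurable al a b u : a < b -> lCaputo_exists al a u b ->
  measurable_fun `[a, b] (derive1 u).
Proof.
move=> ab /integrableP[/measurable_EFinP mk _].
apply/measurable_fun_itv_bndo_bndcP.
have mk' : measurable_fun `[a, b[ (fun t => (b - t) `^ al *
    ((b - t) `^ (- al) * derive1 u t)).
  apply: measurable_funM.
    apply: measurable_funTS.
    have ms : measurable_fun setT (fun t : R => b - t) by exact: measurable_funB.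
    exact: (measurableT_comp (measurable_powR al) ms).
  by apply: measurable_funS mk => //; apply: subset_itvl; rewrite bnd_simp.
apply: eq_measurable_fun mk' => t; rewrite inE /= in_itv/= => /andP[_ tb].
rewrite mulrA powRN mulfV ?mul1r// gt_eqF// powR_gt0// subr_gt0//.
Qed.

(** Fubini moves the kernels onto [B] and [C], turning the [B] term into the integral of u' Q with
    Q' = A + I C by the Euler-Lagrange equation. Integrating by parts, with Q zero at both ends,
    cancels the [A] and [C] terms. *)
Lemma stationary_pairing_eq0 al be a b A B C p u :
  al < 1 -> 0 < be -> a < b ->
  {within `[a, b], continuous A} -> {within `[a, b], continuous B} ->
  {within `[a, b], continuous C} ->
  {within `[a, b], continuous (rRLpot al b B)} ->
  (forall t, a < t < b -> is_derive t 1 (rRLpot al b B) (p t)) ->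
  (forall t, a < t < b -> A t - (Gamma (1 - al))^-1 * p t + rRLint be b C t = 0) ->
  (Gamma (1 - al))^-1 * rRLpot al b B a = 0 ->
  Fclass al be a b u ->
  \int[mu]_(t in `[a, b]) (A t * u t + B t * lCaputo al a u t + C t * lRLint be a u t) = 0.
Proof.
move=> al1 be0 ab Ac Bc Cc Pc dP EL Pa [uac uCex uRLex uCc uRLc]; have ab' := ltW ab.
have al1' : 0 < 1 - al by rewrite subr_gt0.
have alE : 1 - al - 1 = - al by ring.
have uc := abs_cont_on_continuous ab' uac.
pose Gi := (Gamma (1 - al))^-1; pose Q t := Gi * rRLpot al b B t.
pose IC := rRLint be b C; pose q t := A t + IC t.
have Qc : {within `[a, b], continuous Q}.
  by apply: within_continuousM => //; move=> t; exact: cvg_cst.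
have dQ t : a < t < b -> is_derive t 1 Q (q t).
  move=> tab; have := @is_deriveZ _ _ _ _ Gi _ _ _ (dP t tab).
  rewrite (_ : Gi *: p t = q t); first by apply.
  by have := EL t tab; rewrite /q /IC /Gi /GRing.scale/=; lra.
have bbab : a <= b <= b by rewrite ab' lexx.
(* At [b] the potential is an integral over one point; at [a] it vanishes by the natural boundary
   condition. *)
have Qb : Q b = 0 by rewrite /Q /rRLpot set_itv1 Rintegral_set1 mulr0.
have Qa : Q a = 0 by exact: Pa.
(* Applied to the constant 1, the lemma gives integrability, and so measurability, of [IC]. *)
have [ICi1 _] := @fractional_Fubini be a b (Gamma be)^-1 C (cst 1) be0 ab' Cc
  (within_continuous_integrable (fun t => @cvg_cst _ _ _ _ _)).
have ICi : mu.-integrable `[a, b] (EFin \o IC).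
  by apply: eq_integrable ICi1 => // t _; rewrite /= mul1r.
have mIC : measurable_fun `[a, b] IC by case/integrableP : ICi => /measurable_EFinP.
have mq : measurable_fun `[a, b] q.
  by apply: measurable_funD => //; exact: within_continuous_measurable.
have [MA MA0 AM] := within_continuous_bounded ab' Ac.
have [MC CM] := kernel_potential_bounded be0 ab' Cc.
have qM t : a < t < b -> `|q t| <= MA + `|(Gamma be)^-1| * MC.
  move=> /andP[at_ tb]; have tab : a <= t <= b by rewrite !ltW.
  rewrite (le_trans (ler_normD _ _))// lerD ?AM// /IC /rRLint normrM.
  by rewrite ler_wpM2l// CM.
have mu' := Caputo_derive1_measurable ab (uCex b bbab).
have [u'i uQ] := abs_cont_by_parts ab uac mu' Qc dQ qM mq.
have [_ HB] := @fractional_Fubini (1 - al) a b Gi B (derive1 u) al1' ab' Bc u'i.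
have {}HB : \int[mu]_(t in `[a, b]) (B t * lCaputo al a u t) =
    \int[mu]_(t in `[a, b]) (derive1 u t * Q t).
  by rewrite alE in HB; exact: HB.
have [uICi HC] := @fractional_Fubini be a b (Gamma be)^-1 C u be0 ab' Cc
  (within_continuous_integrable uc).
have {}HC : \int[mu]_(t in `[a, b]) (C t * lRLint be a u t) =
    \int[mu]_(t in `[a, b]) (u t * IC t) by exact: HC.
have {}uICi : mu.-integrable `[a, b] (EFin \o (fun t => u t * IC t)) by exact: uICi.
have iAu := within_continuous_integrable (within_continuousM Ac uc).
have iB := within_continuous_integrable (within_continuousM Bc uCc).
have iC := within_continuous_integrable (within_continuousM Cc uRLc).
have iAB := within_continuous_integrable
  (within_continuousD (within_continuousM Ac uc) (within_continuousM Bc uCc)).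
rewrite (Rintegral_itv_add iAB iC) (Rintegral_itv_add iAu iB) HB HC uQ.
rewrite Qa Qb !mulr0 subr0 sub0r.
rewrite (_ : \int[mu]_(t in _) (q t * u t) =
  \int[mu]_(t in `[a, b]) (A t * u t) + \int[mu]_(t in `[a, b]) (u t * IC t)).
  by ring.
rewrite -(Rintegral_itv_add iAu uICi).
by apply: eq_Rintegral => t _; rewrite /q; ring.
Qed.
End Pairing.

(** * Sufficiency of the Euler-Lagrange equation *)

Section Along.
Variable R : realType.
Notation mu := (@lebesgue_measure R).
Implicit Types (a b al be t : R).

Lemma within_continuous_tail a b (f : R -> R) : a <= b ->
  {within `[a, b], continuous f} ->
  {within `[a, b], continuous (fun t => \int[mu]_(s in `[t, b]) f s)}.
Proof.
move=> ab fc; have fi := within_continuous_integrable fc.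
pose F t := \int[mu]_(s in `[a, b]) f s - \int[mu]_(s in `[a, t]) f s.
apply: (@subspace_eq_continuous _ _ _ F).
  move=> t; rewrite inE /= in_itv/= => /andP[at_ tb].
  rewrite /F (@Rintegral_itvB R f (BLeft a) (BRight b) t fi) ?bnd_simp//.
  rewrite Rintegral_itv_obnd_cbnd//.
  by apply: integrableS fi => //; apply: subset_itvr; rewrite bnd_simp.
move=> t; apply: cvgB; first exact: cvg_cst.
exact: (parameterized_integral_continuous ab fi).
Qed.

Lemma within_continuous_along4 (D : set R) (P : R -> R -> R -> R -> R) (x v w : R -> R) :
  continuous (fun p : R * R * R * R => P p.1.1.1 p.1.1.2 p.1.2 p.2) ->
  {within D, continuous x} -> {within D, continuous v} -> {within D, continuous w} ->
  {within D, continuous (fun t => P t (x t) (v t) (w t))}.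
Proof.
move=> Pc xc vc wc.
have idc : {within D, continuous (@id R)} by apply: continuous_subspaceT => t; exact: cvg_id.
exact: (within_continuous_comp
  (within_continuous_pair (within_continuous_pair (within_continuous_pair idc xc) vc) wc) Pc).
Qed.

Lemma within_continuous_along5 (D : set R) (P : R -> R -> R -> R -> R -> R)
    (x v w z : R -> R) :
  continuous (fun p : R * R * R * R * R => P p.1.1.1.1 p.1.1.1.2 p.1.1.2 p.1.2 p.2) ->
  {within D, continuous x} -> {within D, continuous v} -> {within D, continuous w} ->
  {within D, continuous z} ->
  {within D, continuous (fun t => P t (x t) (v t) (w t) (z t))}.
Proof.
move=> Pc xc vc wc zc.
have idc : {within D, continuous (@id R)} by apply: continuous_subspaceT => t; exact: cvg_id.
exact: (within_continuous_comp (within_continuous_pair (within_continuous_pair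
  (within_continuous_pair (within_continuous_pair idc xc) vc) wc) zc) Pc).
Qed.

Lemma rRLintD ga b (f g : R -> R) a t : 0 < ga -> a <= t <= b ->
  {within `[a, b], continuous f} -> {within `[a, b], continuous g} ->
  rRLint ga b (fun s => f s + g s) t = rRLint ga b f t + rRLint ga b g t.
Proof.
move=> ga0 /[dup] tab /andP[at_ tb] fc gc; rewrite /rRLint -mulrDr; congr (_ * _).
have ab := le_trans at_ tb.
rewrite -(Rintegral_itv_add (kernel_integrable ga0 ab fc tab) (kernel_integrable ga0 ab gc tab)).
by apply: eq_Rintegral => s _; ring.
Qed.

(** The Euler-Lagrange equation differentiates the potentials of the two summands of [B] separately,
    while [stationary_pairing_eq0] asks for that of [B]. Continuity makes both kernel integrals
    converge. *)
Lemma rRLpotD al b (f g : R -> R) a t : al < 1 -> a <= t <= b ->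
  {within `[a, b], continuous f} -> {within `[a, b], continuous g} ->
  rRLpot al b (fun s => f s + g s) t = rRLpot al b f t + rRLpot al b g t.
Proof.
move=> al1 /[dup] tab /andP[at_ tb] fc gc; rewrite /rRLpot.
have ab := le_trans at_ tb; have al1' : 0 < 1 - al by rewrite subr_gt0.
have := Rintegral_itv_add (kernel_integrable al1' ab fc tab) (kernel_integrable al1' ab gc tab).
rewrite (_ : 1 - al - 1 = - al); last by ring.
by move=> <-; apply: eq_Rintegral => s _; ring.
Qed.

Lemma convex5_sub (L : R -> R -> R -> R -> R -> R) t x v w z x' v' w' z' : convex5 L ->
  pd5_2 L t x v w z * (x' - x) + pd5_3 L t x v w z * (v' - v) +
  pd5_4 L t x v w z * (w' - w) + pd5_5 L t x v w z * (z' - z) <=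
  L t x' v' w' z' - L t x v w z.
Proof.
move=> /(_ t x v w z (x' - x) (v' - v) (w' - w) (z' - z)).
by rewrite !subrKC.
Qed.

Lemma convex4_sub (l : R -> R -> R -> R -> R) t x v w x' v' w' : convex4 l ->
  pd4_2 l t x v w * (x' - x) + pd4_3 l t x v w * (v' - v) +
  pd4_4 l t x v w * (w' - w) <= l t x' v' w' - l t x v w.
Proof.
move=> /(_ t x v w (x' - x) (v' - v) (w' - w)).
by rewrite !subrKC.
Qed.

Lemma concave4_sub (l : R -> R -> R -> R -> R) t x v w x' v' w' : concave4 l ->
  l t x' v' w' - l t x v w <= pd4_2 l t x v w * (x' - x) +
  pd4_3 l t x v w * (v' - v) + pd4_4 l t x v w * (w' - w).
Proof.
move=> /(_ t x v w (x' - x) (v' - v) (w' - w)).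
by rewrite !subrKC.
Qed.

(** The first-order terms in the increments, with the order of integration already exchanged, are
    the pairing integrand of the competitor minus that of the candidate. *)
Lemma pairing_sub (Lx Lv Lw lx lv lw T x v w x' v' w' : R) :
  Lx * (x' - x) + Lv * (v' - v) + Lw * (w' - w) +
    (lx * (x' - x) + lv * (v' - v) + lw * (w' - w)) * T =
  (Lx + T * lx) * x' + (Lv + T * lv) * v' + (Lw + T * lw) * w' -
  ((Lx + T * lx) * x + (Lv + T * lv) * v + (Lw + T * lw) * w).
Proof. by ring. Qed.

Lemma Euler_Lagrange_sum (Gi Lx Lw Tlx Tlw d1 d2 : R) :
  Lx + Tlx - Gi * (d1 + d2) + (Lw + Tlw) =
  Lx + - (Gi * d1) + Lw + Tlx + - (Gi * d2) + Tlw.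
Proof. by ring. Qed.
End Along.

Theorem theorem10p11 (R : realType) (al be a b : R)
  (L : R -> R -> R -> R -> R -> R) (l : R -> R -> R -> R -> R) (x : R -> R) :
  0 < al < 1 -> 0 < be -> a < b ->
  C1_5 L -> C1_4 l ->
  Fclass al be a b x ->
  (* existence of the right Riemann-Liouville derivatives in the Euler-Lagrange equation *)
  (forall t, a <= t <= b ->
     rRLder_exists al a b (along5 al be a pd5_3 L l x) t /\
     rRLder_exists al a b
       (fun s => tailLz al be a b L l x s * along4 al be a pd4_3 l x s) t) ->
  (* Euler-Lagrange equation *)
  (forall t, a <= t <= b ->
     along5 al be a pd5_2 L l x t
     + rRLder al a b (along5 al be a pd5_3 L l x) t
     + rRLint be b (along5 al be a pd5_4 L l x) t
     + tailLz al be a b L l x t * along4 al be a pd4_2 l x t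
     + rRLder al a b (fun s => tailLz al be a b L l x s * along4 al be a pd4_3 l x s) t
     + rRLint be b (fun s => tailLz al be a b L l x s * along4 al be a pd4_4 l x s) t
     = 0) ->
  (* natural boundary condition *)
  rRLint (1 - al) b
    (fun s => along5 al be a pd5_3 L l x s
              + tailLz al be a b L l x s * along4 al be a pd4_3 l x s) a = 0 ->
  convex5 L ->
  ((convex4 l /\ (forall t, a <= t <= b -> 0 <= along5 al be a pd5_5 L l x t)) \/
   (concave4 l /\ (forall t, a <= t <= b -> along5 al be a pd5_5 L l x t <= 0))) ->
  forall y : R -> R, Fclass al be a b y -> Jfun al be a b L l x <= Jfun al be a b L l y.
Proof.
move=> /andP[al0 al1] be0 ab CL Cl Fx der EL nbc Lconv lconv y Fy.
have ab' := ltW ab.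
have Lc := C1_5_continuous CL; have lc := C1_4_continuous Cl.
have cVx : {within `[a, b], continuous (lCaputo al a x)} by case: Fx.
have cWx : {within `[a, b], continuous (lRLint be a x)} by case: Fx.
have cx : {within `[a, b], continuous x}.
  by apply: abs_cont_on_continuous => //; case: Fx.
have cVy : {within `[a, b], continuous (lCaputo al a y)} by case: Fy.
have cWy : {within `[a, b], continuous (lRLint be a y)} by case: Fy.
have cy : {within `[a, b], continuous y}.
  by apply: abs_cont_on_continuous => //; case: Fy.
have clx := within_continuous_along4 lc cx cVx cWx.
have cly := within_continuous_along4 lc cy cVy cWy.
have ilx := within_continuous_integrable clx.
have ily := within_continuous_integrable cly.
have cZx : {within `[a, b], continuous (zvar al be a l x)}.
  exact: (parameterized_integral_continuous ab' ilx).
have cZy : {within `[a, b], continuous (zvar al be a l y)}.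
  exact: (parameterized_integral_continuous ab' ily).
pose Lx := along5 al be a pd5_2 L l x; pose Lv := along5 al be a pd5_3 L l x.
pose Lw := along5 al be a pd5_4 L l x; pose Lz := along5 al be a pd5_5 L l x.
pose lx := along4 al be a pd4_2 l x; pose lv := along4 al be a pd4_3 l x.
pose lw := along4 al be a pd4_4 l x; pose T := tailLz al be a b L l x.
have [_ [_ CL2 CL3 CL4 CL5]] := CL; have [_ [_ Cl2 Cl3 Cl4]] := Cl.
have cLx : {within `[a, b], continuous Lx} := within_continuous_along5 CL2 cx cVx cWx cZx.
have cLv : {within `[a, b], continuous Lv} := within_continuous_along5 CL3 cx cVx cWx cZx.
have cLw : {within `[a, b], continuous Lw} := within_continuous_along5 CL4 cx cVx cWx cZx.
have cLz : {within `[a, b], continuous Lz} := within_continuous_along5 CL5 cx cVx cWx cZx.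
have clx2 : {within `[a, b], continuous lx} := within_continuous_along4 Cl2 cx cVx cWx.
have clv : {within `[a, b], continuous lv} := within_continuous_along4 Cl3 cx cVx cWx.
have clw : {within `[a, b], continuous lw} := within_continuous_along4 Cl4 cx cVx cWx.
have cT : {within `[a, b], continuous T} := within_continuous_tail ab' cLz.
have cTx := within_continuousM cT clx2; have cTv := within_continuousM cT clv.
have cTw := within_continuousM cT clw.
have cA := within_continuousD cLx cTx; have cB := within_continuousD cLv cTv.
have cC := within_continuousD cLw cTw.
set A := (fun t => Lx t + T t * lx t) in cA.
set B := (fun t => Lv t + T t * lv t) in cB.
set C := (fun t => Lw t + T t * lw t) in cC.
pose p t := deriv_in a b (rRLpot al b Lv) t +
  deriv_in a b (rRLpot al b (fun s => T s * lv s)) t.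
have potB t : a <= t <= b ->
    rRLpot al b Lv t + rRLpot al b (fun s => T s * lv s) t = rRLpot al b B t.
  by move=> tab; rewrite (rRLpotD al1 tab cLv cTv).
(* Derivability within the segment includes the end points, so the potential is continuous up to [a]
   and [b], as the integration by parts requires. *)
have cP : {within `[a, b], continuous (rRLpot al b B)}.
  apply: (@subspace_eq_continuous _ _ _
    (fun t => rRLpot al b Lv t + rRLpot al b (fun s => T s * lv s) t)).
    by move=> t; rewrite inE /= in_itv/=; exact: potB.
  apply: within_continuousD; apply: derivable_in_continuous => t tab.
    by have [d _] := der t tab; exact: d.
  by have [_ d] := der t tab; exact: d.
have dP t : a < t < b -> is_derive t 1 (rRLpot al b B) (p t).
  move=> tab; have tin : t \in `]a, b[ by rewrite in_itv.
  have tab' : a <= t <= b by case/andP : tab => at_ tb; rewrite !ltW.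
  have [d1 d2] := der t tab'.
  apply: (@near_eq_is_derive _ _ _
    (rRLpot al b Lv + rRLpot al b (fun s => T s * lv s))); last first.
    apply: is_deriveD; first exact: (derivable_in_interior tab d1).
    exact: (derivable_in_interior tab d2).
  near=> s; apply: potB.
  have : s \in `]a, b[ by near: s; exact: near_in_itvoo.
  by rewrite in_itv/= => /andP[as_ sb]; rewrite !ltW.
have EL' t : a < t < b -> A t - (Gamma (1 - al))^-1 * p t + rRLint be b C t = 0.
  move=> /andP[at_ tb]; have tab : a <= t <= b by rewrite !ltW.
  rewrite (rRLintD be0 tab cLw cTw) -[RHS](EL t tab).
  exact: Euler_Lagrange_sum.
have nbc' : (Gamma (1 - al))^-1 * rRLpot al b B a = 0.
  by move: nbc; rewrite /rRLint (_ : 1 - al - 1 = - al)//; ring.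
have pairing u := stationary_pairing_eq0 (u := u) al1 be0 ab cA cB cC cP dP EL' nbc'.
pose Vx := lCaputo al a x; pose Vy := lCaputo al a y.
pose Wx := lRLint be a x; pose Wy := lRLint be a y.
pose G t := lx t * (y t - x t) + lv t * (Vy t - Vx t) + lw t * (Wy t - Wx t).
pose M1 t := Lx t * (y t - x t) + Lv t * (Vy t - Vx t) + Lw t * (Wy t - Wx t).
(* [G] is the linearization of [l] along [x]; its integral stands in for the difference of the [z]
   variables. *)
pose M2 t := Lz t * \int[lebesgue_measure]_(s in `[a, t]) G s.
have cyx := within_continuousB cy cx.
have cVV := within_continuousB cVy cVx; have cWW := within_continuousB cWy cWx.
have cG : {within `[a, b], continuous G} := within_continuousD (within_continuousD
  (within_continuousM clx2 cyx) (within_continuousM clv cVV)) (within_continuousM clw cWW).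
have cM1 : {within `[a, b], continuous M1} := within_continuousD (within_continuousD
  (within_continuousM cLx cyx) (within_continuousM cLv cVV)) (within_continuousM cLw cWW).
have iG := within_continuous_integrable cG.
have cIG : {within `[a, b], continuous (fun t => \int[lebesgue_measure]_(s in `[a, t]) G s)}.
  exact: (parameterized_integral_continuous ab' iG).
have cM2 : {within `[a, b], continuous M2} := within_continuousM cLz cIG.
have iM1 := within_continuous_integrable cM1.
have iM2 := within_continuous_integrable cM2.
have cGT := within_continuousM cG cT.
have iGT := within_continuous_integrable cGT.
(* Convexity puts the integral of [G] below the difference of the [z] variables and [Lz] is
   nonnegative; in the concave case both signs are reversed, so the product inequality is the
   same. *)
have zvar_le t : a <= t <= b ->
    Lz t * \int[lebesgue_measure]_(s in `[a, t]) G s <= Lz t * (zvar al be a l y t - zvar al be a l x t).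
  move=> tab; have sub : `[a, t] `<=` `[a, b].
    by apply: subset_itvl; rewrite bnd_simp; case/andP : tab.
  have iS f : lebesgue_measure.-integrable `[a, b] (EFin \o f) -> lebesgue_measure.-integrable `[a, t] (EFin \o f).
    by move=> fi; apply: integrableS fi.
  rewrite /zvar -(Rintegral_itv_sub (iS _ ily) (iS _ ilx)).
  have idl := iS _ (within_continuous_integrable (within_continuousB cly clx)).
  case: lconv => -[lcv Lz0].
    apply: ler_wpM2l; first exact: Lz0.
    apply: le_Rintegral => //; first exact: iS.
    by move=> s _; exact: convex4_sub.
  apply: ler_wnM2l; first exact: Lz0.
  apply: le_Rintegral => //; first exact: iS.
  by move=> s _; exact: concave4_sub.
have cLfx := within_continuous_along5 Lc cx cVx cWx cZx.
have cLfy := within_continuous_along5 Lc cy cVy cWy cZy.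
have L_le t : a <= t <= b -> M1 t + M2 t <=
    L t (y t) (Vy t) (Wy t) (zvar al be a l y t) -
    L t (x t) (Vx t) (Wx t) (zvar al be a l x t).
  move=> tab; apply: le_trans (convex5_sub _ _ _ _ _ _ _ _ _ Lconv).
  by rewrite lerD2l; exact: zvar_le.
have pairing_integrable u : Fclass al be a b u -> {within `[a, b], continuous
    (fun t => A t * u t + B t * lCaputo al a u t + C t * lRLint be a u t)}.
  move=> Fu; have cu : {within `[a, b], continuous u}.
    by apply: abs_cont_on_continuous => //; case: Fu.
  case: Fu => _ _ _ cVu cWu.
  exact: (within_continuousD (within_continuousD (within_continuousM cA cu)
    (within_continuousM cB cVu)) (within_continuousM cC cWu)).
have M0 : \int[lebesgue_measure]_(t in `[a, b]) (M1 t + M2 t) = 0.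
  (* Exchanging the integrals collects [Lz] into its tail integral [T], which produces the
     coefficients [A], [B], [C]. *)
  rewrite (Rintegral_itv_add iM1 iM2) (triangle_Fubini (within_continuous_integrable cLz) iG).
  (* Zero is written as the pairing of [y] minus that of [x]. Subtracting the two integrals avoids
     additivity of [derive1], which may fail where a derivative does not exist. *)
  rewrite -(Rintegral_itv_add iM1 iGT) -[RHS](subrr 0) -{1}(pairing y Fy) -(pairing x Fx).
  rewrite -(Rintegral_itv_sub (within_continuous_integrable (pairing_integrable y Fy))
    (within_continuous_integrable (pairing_integrable x Fx))).
  by apply: eq_Rintegral => t _; exact: pairing_sub.
(* Zero is replaced by the integral of [M1 + M2], so the pointwise bound [L_le] can be
   integrated. *)
rewrite -subr_ge0 /Jfun -(Rintegral_itv_sub (within_continuous_integrable cLfy)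
  (within_continuous_integrable cLfx)) -M0.
apply: le_Rintegral.
- exact: measurable_itv.
- exact: (within_continuous_integrable (within_continuousD cM1 cM2)).
- exact: (within_continuous_integrable (within_continuousB cLfy cLfx)).
- by move=> t; rewrite /= in_itv/=; exact: L_le.
Unshelve. all: by end_near. Qed.
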